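(* Let $S$ be a discrete valuation ring, $G$ a finite subgroup of $\mathrm{Aut}(S)$, $R=S^G$, and assume that the residue field extension $\bar S/\bar R$ is separable. Let $f\in Z^2(G,S^* )$. If the crossed product $S^f*G$ is a maximal $R$-order in $L^f*G$ (where $L$ is the field of quotients of $S$) or, more generally, a hereditary $R$-order, then the inertia subgroup $G_I$ of $G$ is abelian.
   Context: $M_S$ is the maximal ideal of $S$, $\bar S=S/M_S$, and $\bar R=R/(M_S\cap R)$. For $f\in Z^2(G,S^* )$, the crossed product $S^f*G=\bigoplus_{g\in G}SU_g$ is the free left $S$-module on symbols $U_g$ with multiplication $sU_g\,tU_h=s\,g(t)f(g,h)U_{gh}$ for $s,t\in S$, $g,h\in G$. It is an $R$-order in the central simple algebra $L^f*G$ (defined by the same formula over $L$, viewing $f$ in $Z^2(G,L^* )$). The inertia subgroup $G_I\lhd G$ is the kernel of the induced action of $G$ on $\bar S$. The 2-cocycles are normalized. *)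

(* Defs.v *)
From HB Require Import structures.
From mathcomp Require Import all_boot all_fingroup all_algebra all_field.
From mathcomp Require Import generic_quotient boolp.

Set Implicit Arguments.
Unset Strict Implicit.
Unset Printing Implicit Defensive.

Import GRing.Theory.
Local Open Scope ring_scope.
Local Open Scope quotient_scope.

Notation "x %:F" := (@FracField.tofrac _ x) : ring_scope.

(* A discrete valuation ring is a local principal ideal domain that is not a
   field.  [idealr_closed] describes the proper ideals; the improper one is
   always principal. *)
HB.mixin Record IntegralDomain_isDVR S of GRing.IntegralDomain S := {
  dvr_local : forall x y : S,
    x \isn't a GRing.unit -> y \isn't a GRing.unit ->
    x + y \isn't a GRing.unit;
  dvr_principal : forall I : {pred S}, idealr_closed I ->
    exists a : S, forall x : S, x \in I <-> exists y : S, x = y * a;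
  dvr_nonfield : exists x : S, x != 0 /\ x \isn't a GRing.unit
}.
#[short(type="dvrType")]
HB.structure Definition DVR :=
  { S of GRing.IntegralDomain S & IntegralDomain_isDVR S }.

Section Residue.
Variable S : dvrType.

Definition maxideal : {pred S} := [pred x | x \isn't a GRing.unit].

Fact maxideal_closed : idealr_closed maxideal.
Proof.
split; rewrite ?inE ?unitr0 ?unitr1 // => a x y; rewrite !inE => xM yM.
by apply: dvr_local; rewrite // unitrM negb_and xM orbT.
Qed.
HB.instance Definition _ := isIdealr.Build S maxideal maxideal_closed.

Definition residue := {ideal_quot maxideal}.
HB.instance Definition _ := GRing.ComNzRing.on residue.
HB.instance Definition _ := EqQuotient.on residue.

Definition res (x : S) : residue := \pi_residue x.

Fact res_is_zmod_morphism : zmod_morphism res.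
Proof. by move=> x y; rewrite /res !piE. Qed.
Fact res_is_monoid_morphism : monoid_morphism res.
Proof. by split=> [|x y]; rewrite /res !piE. Qed.
HB.instance Definition _ := GRing.isZmodMorphism.Build S residue res
  res_is_zmod_morphism.
HB.instance Definition _ := GRing.isMonoidMorphism.Build S residue res
  res_is_monoid_morphism.

Lemma res_surj (x : residue) : res (repr x) = x.
Proof. exact: reprK. Qed.

Lemma res_eq0 (x : S) : (res x == 0) = (x \in maxideal).
Proof.
rewrite -(subr0 x) -[in LHS](rmorph0 res).
by rewrite Quotient.idealrBE subr0.
Qed.

Definition residue_inv (x : residue) : residue :=
  if x == 0 then 0 else res (repr x)^-1.

Fact residue_mulVf (x : residue) : x != 0 -> residue_inv x * x = 1.
Proof.
move=> x0; rewrite /residue_inv (negPf x0) -[X in _ * X](res_surj x).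
have xU : repr x \is a GRing.unit.
  by move: x0; rewrite -[in X in X -> _](res_surj x) res_eq0 inE negbK.
by rewrite -rmorphM mulVr // rmorph1.
Qed.
Fact residue_inv0 : residue_inv 0 = 0.
Proof. by rewrite /residue_inv eqxx. Qed.
HB.instance Definition _ :=
  GRing.ComNzRing_isField.Build residue residue_mulVf residue_inv0.
End Residue.
Arguments maxideal S : clear implicits.


Section SeparableExtension.
Variables (F : fieldType) (K : {pred F}).

Definition is_min_poly (x : F) (p : {poly F}) : Prop :=
  [/\ p \is monic, p \is a polyOver K, root p x &
      forall q : {poly F}, q \is a polyOver K -> root q x -> p %| q].

(* F is a separable (algebraic) extension of its subfield K. *)
Definition separable_ext : Prop :=
  forall x : F, exists2 p : {poly F}, is_min_poly x p & separable_poly p.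
End SeparableExtension.

(* A homomorphism from gT to the group of ring automorphisms of A; when it is
   faithful, gT is identified with a finite subgroup of Aut(A). *)
Record ring_action (gT : finGroupType) (A : nzRingType) := RingAction {
  ract :> gT -> {rmorphism A -> A};
  ract1 : forall a : A, ract 1%g a = a;
  ractM : forall (g h : gT) (a : A), ract (g * h)%g a = ract g (ract h a)
}.

Section RingActionTheory.
Variables (gT : finGroupType) (A : nzRingType) (sigma : ring_action gT A).

Definition faithful_action : Prop :=
  forall g : gT, (forall a : A, sigma g a = a) -> g = 1%g.

Definition fixed_ring : {pred A} := [pred a | [forall g, sigma g a == a]].

Lemma ractK g : cancel (sigma g) (sigma g^-1%g).
Proof. by move=> a; rewrite -ractM mulVg ract1. Qed.
End RingActionTheory.

Section ResidueAction.
Variables (S : dvrType) (gT : finGroupType) (sigma : ring_action gT S).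

Lemma ract_maxideal g (x : S) : (sigma g x \in maxideal S) = (x \in maxideal S).
Proof.
rewrite !inE; congr (~~ _); apply/idP/idP => xU; last exact: rmorph_unit.
by rewrite -(ractK sigma g x) rmorph_unit.
Qed.

Definition res_act_fun (g : gT) (x : residue S) : residue S :=
  res (sigma g (repr x)).

Lemma res_act_fun_res g (x : S) : res_act_fun g (res x) = res (sigma g x).
Proof.
apply/eqP; rewrite -subr_eq0 /res_act_fun -2!rmorphB /= res_eq0.
by rewrite ract_maxideal -res_eq0 rmorphB /= res_surj subrr.
Qed.

Fact res_act_is_zmod_morphism g : zmod_morphism (res_act_fun g).
Proof.
move=> x y; rewrite -(res_surj x) -(res_surj y) -rmorphB !res_act_fun_res.
by rewrite !rmorphB.
Qed.
Fact res_act_is_monoid_morphism g : monoid_morphism (res_act_fun g).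
Proof.
split=> [|x y]; first by rewrite -(rmorph1 (@res S)) res_act_fun_res !rmorph1.
rewrite -(res_surj x) -(res_surj y) -rmorphM !res_act_fun_res.
by rewrite !rmorphM.
Qed.
HB.instance Definition _ g := GRing.isZmodMorphism.Build _ _ (res_act_fun g)
  (res_act_is_zmod_morphism g).
HB.instance Definition _ g := GRing.isMonoidMorphism.Build _ _ (res_act_fun g)
  (res_act_is_monoid_morphism g).

Fact res_act1 (x : residue S) : res_act_fun 1%g x = x.
Proof. by rewrite -(res_surj x) res_act_fun_res ract1. Qed.
Fact res_actM (g h : gT) (x : residue S) :
  res_act_fun (g * h)%g x = res_act_fun g (res_act_fun h x).
Proof. by rewrite -(res_surj x) !res_act_fun_res ractM. Qed.

Definition res_action : ring_action gT (residue S) :=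
  @RingAction gT (residue S) res_act_fun res_act1 res_actM.

Lemma res_actionE g (x : S) : res_action g (res x) = res (sigma g x).
Proof. exact: res_act_fun_res. Qed.

Definition inertia : {set gT} :=
  [set g | `[< forall x : residue S, res_action g x = x >]].

(* The image in S / M_S of R = S^G, that is, R / (M_S \cap R). *)
Definition residue_fixed : {pred residue S} :=
  [pred y | `[< exists2 r : S, r \in fixed_ring sigma & y = res r >]].
End ResidueAction.

Section FractionAction.
Variables (S : idomainType) (gT : finGroupType) (sigma : ring_action gT S).

Lemma fracE (x : {fraction S}) : x = (\n_(repr x))%:F / (\d_(repr x))%:F.
Proof.
have d0 : (\d_(repr x))%:F != 0 :> {fraction S}.
  by rewrite tofrac_eq0 denom_ratioP.
apply: (mulIf d0); rewrite divfK //.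
rewrite -[X in X * _](reprK x); move: (repr x) => y.
have ty (a : S) : a%:F = \pi_{fraction S} (Ratio a 1).
  by unlock FracField.tofrac.
rewrite !ty -[LHS]FracField.pi_mul /FracField.mulf.
rewrite !numden_Ratio ?oner_eq0 // mulr1; apply/eqmodP.
rewrite /= FracField.equivfE !numden_Ratio ?oner_eq0 ?denom_ratioP //.
by rewrite mulr1 mulrC.
Qed.

Lemma fracP (x : {fraction S}) :
  exists ab : S * S, ab.2 != 0 /\ x = ab.1%:F / ab.2%:F.
Proof.
by exists (\n_(repr x), \d_(repr x)); rewrite /= denom_ratioP -fracE.
Qed.

Definition frac_act_fun (g : gT) (x : {fraction S}) : {fraction S} :=
  (sigma g \n_(repr x))%:F / (sigma g \d_(repr x))%:F.

Lemma ract_neq0 g (b : S) : b != 0 -> sigma g b != 0.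
Proof.
by apply: contraNneq => sb0; rewrite -(ractK sigma g b) sb0 rmorph0.
Qed.

Lemma frac_act_fun_frac g (a b : S) : b != 0 ->
  frac_act_fun g (a%:F / b%:F) = (sigma g a)%:F / (sigma g b)%:F.
Proof.
move=> b0; rewrite /frac_act_fun; set x := a%:F / b%:F.
have d0 : \d_(repr x) != 0 by apply: denom_ratioP.
apply/eqP; rewrite eqr_div ?tofrac_eq0 ?ract_neq0 //.
rewrite -!tofracM -!rmorphM /= tofrac_eq; apply/eqP; congr (sigma g _).
apply/eqP; rewrite -tofrac_eq !tofracM -eqr_div ?tofrac_eq0 //.
by rewrite -fracE.
Qed.

Lemma frac_act_fun_tofrac g (a : S) : frac_act_fun g a%:F = (sigma g a)%:F.
Proof.
rewrite -[a%:F]divr1 -tofrac1 frac_act_fun_frac ?oner_neq0 //.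
by rewrite rmorph1 !tofrac1 divr1.
Qed.

Fact frac_act_is_zmod_morphism g : zmod_morphism (frac_act_fun g).
Proof.
move=> x y; have [[a b] [/= b0 ->]] := fracP x.
have [[c d] [/= d0 ->]] := fracP y.
rewrite -mulNr addf_div ?tofrac_eq0 // -!tofracN -!tofracM -tofracD.
rewrite !frac_act_fun_frac ?mulf_neq0 // !(rmorphM, rmorphD, rmorphN) /=.
by rewrite -mulNr addf_div ?tofrac_eq0 ?ract_neq0.
Qed.
Fact frac_act_is_monoid_morphism g : monoid_morphism (frac_act_fun g).
Proof.
split=> [|x y]; first by rewrite -tofrac1 frac_act_fun_tofrac rmorph1.
have [[a b] [/= b0 ->]] := fracP x; have [[c d] [/= d0 ->]] := fracP y.
rewrite mulf_div -!tofracM !frac_act_fun_frac ?mulf_neq0 //.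
by rewrite mulf_div !rmorphM.
Qed.
HB.instance Definition _ g := GRing.isZmodMorphism.Build _ _ (frac_act_fun g)
  (frac_act_is_zmod_morphism g).
HB.instance Definition _ g := GRing.isMonoidMorphism.Build _ _ (frac_act_fun g)
  (frac_act_is_monoid_morphism g).

Fact frac_act1 (x : {fraction S}) : frac_act_fun 1%g x = x.
Proof.
by have [[a b] [/= b0 ->]] := fracP x; rewrite frac_act_fun_frac // !ract1.
Qed.
Fact frac_actM (g h : gT) (x : {fraction S}) :
  frac_act_fun (g * h)%g x = frac_act_fun g (frac_act_fun h x).
Proof.
have [[a b] [/= b0 ->]] := fracP x.
by rewrite !frac_act_fun_frac ?ract_neq0 // !ractM.
Qed.

Definition frac_action : ring_action gT {fraction S} :=
  @RingAction gT {fraction S} frac_act_fun frac_act1 frac_actM.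

Lemma frac_actionE g (a : S) : frac_action g a%:F = (sigma g a)%:F.
Proof. exact: frac_act_fun_tofrac. Qed.

(* R = S^G, seen inside the quotient field of S. *)
Definition frac_fixed_ring : {pred {fraction S}} :=
  [pred y | `[< exists2 r : S, r \in fixed_ring sigma & y = r%:F >]].
End FractionAction.

(* Normalized 2-cocycles in Z^2(G, A^* ). *)
Record cocycle2 (gT : finGroupType) (A : comUnitRingType)
    (sigma : ring_action gT A) := Cocycle2 {
  cocycle2_fun :> gT -> gT -> A;
  cocycle2_unit : forall g h, cocycle2_fun g h \is a GRing.unit;
  cocycle2P : forall g h k,
    cocycle2_fun g h * cocycle2_fun (g * h)%g k =
    sigma g (cocycle2_fun h k) * cocycle2_fun g (h * k)%g;
  cocycle2_1g : forall g, cocycle2_fun 1%g g = 1;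
  cocycle2_g1 : forall g, cocycle2_fun g 1%g = 1
}.

Section CrossedProduct.
Variables (gT : finGroupType) (A : comUnitRingType).
Variable sigma : ring_action gT A.

(* A^f * G: the finite function x stands for \sum_g (x g) U_g. *)
Definition crossed_product (f : cocycle2 sigma) : Type := {ffun gT -> A}.

Variable f : cocycle2 sigma.
Local Notation crossed := (crossed_product f).
HB.instance Definition _ := GRing.Zmodule.copy crossed {ffun gT -> A}.

Implicit Types (x y z : crossed) (a b : A) (g h k : gT).

Definition crossed_one : crossed := [ffun g => if g == 1%g then 1 else 0].
Definition crossed_mul x y : crossed :=
  [ffun k => \sum_g \sum_(h | (g * h)%g == k) x g * sigma g (y h) * f g h].
Definition crossed_scale a x : crossed := [ffun g => a * x g].

Lemma crossed_mulE x y k : crossed_mul x y k =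
  \sum_g x g * sigma g (y (g^-1 * k)%g) * f g (g^-1 * k)%g.
Proof.
rewrite ffunE; apply: eq_bigr => g _.
by rewrite (big_pred1 (g^-1 * k)%g) // => h; rewrite -(inj_eq (mulgI g^-1%g)) mulKg.
Qed.

Fact crossed_mulA : associative crossed_mul.
Proof.
move=> x y z; apply/ffunP => k; rewrite !crossed_mulE.
under eq_bigr => a _.
  rewrite crossed_mulE rmorph_sum /= mulr_sumr mulr_suml.
  rewrite (reindex_inj (mulgI a^-1%g)) /=.
  over.
rewrite exchange_big /=; apply: eq_bigr => g _.
rewrite crossed_mulE mulr_suml mulr_suml; apply: eq_bigr => a _.
have -> : ((a^-1 * g)^-1 * (a^-1 * k) = g^-1 * k)%g.
  by rewrite invMg invgK -mulgA mulKVg.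
rewrite !rmorphM /= -ractM mulKVg.
set h := (a^-1 * g)%g; set l := (g^-1 * k)%g.
have -> : (a^-1 * k = h * l)%g by rewrite /h /l -mulgA mulKVg.
have := cocycle2P f a h l; rewrite [(a * h)%g]mulKVg => E.
transitivity (x a * sigma a (y h) * sigma g (z l) *
  (sigma a (f h l) * f a (h * l)%g)); first by rewrite !mulrA.
by rewrite -E; rewrite !mulrA; congr (_ * _); rewrite mulrAC.
Qed.

Fact crossed_mul1r : left_id crossed_one crossed_mul.
Proof.
move=> x; apply/ffunP => k; rewrite crossed_mulE (bigD1 1%g) //= big1.
  by rewrite ffunE eqxx invg1 mul1g ract1 cocycle2_1g mul1r mulr1 addr0.
by move=> g /negPf g1; rewrite ffunE g1 !mul0r.
Qed.

Fact crossed_mulDl : left_distributive crossed_mul +%R.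
Proof.
move=> x y z; apply/ffunP => k.
rewrite [RHS]ffunE !crossed_mulE -big_split /=; apply: eq_bigr => g _.
by rewrite ffunE !mulrDl.
Qed.

Fact crossed_mulDr : right_distributive crossed_mul +%R.
Proof.
move=> x y z; apply/ffunP => k.
rewrite [RHS]ffunE !crossed_mulE -big_split /=; apply: eq_bigr => g _.
by rewrite ffunE rmorphD mulrDr mulrDl.
Qed.

Fact crossed_1neq0 : crossed_one != 0.
Proof.
by apply/eqP => /ffunP /(_ 1%g); rewrite !ffunE eqxx; apply/eqP/oner_neq0.
Qed.

Fact crossed_mulr1 : right_id crossed_one crossed_mul.
Proof.
move=> x; apply/ffunP => k; rewrite crossed_mulE (bigD1 k) //= big1.
  by rewrite mulVg ffunE eqxx rmorph1 cocycle2_g1 !mulr1 addr0.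
move=> g gk; rewrite ffunE ifN ?rmorph0 ?mulr0 ?mul0r //.
by apply: contraNneq gk => /(congr1 (mulg g)); rewrite mulKVg mulg1 => ->.
Qed.

HB.instance Definition _ := GRing.Zmodule_isNzRing.Build crossed
  crossed_mulA crossed_mul1r crossed_mulr1 crossed_mulDl crossed_mulDr
  crossed_1neq0.

Fact crossed_scaleA a b x :
  crossed_scale a (crossed_scale b x) = crossed_scale (a * b) x.
Proof. by apply/ffunP => g; rewrite !ffunE mulrA. Qed.
Fact crossed_scale1 : left_id 1 crossed_scale.
Proof. by move=> x; apply/ffunP => g; rewrite !ffunE mul1r. Qed.
Fact crossed_scaleDr : right_distributive crossed_scale +%R.
Proof. by move=> a x y; apply/ffunP => g; rewrite !ffunE mulrDr. Qed.
Fact crossed_scaleDl x :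
  {morph crossed_scale^~ x : a b / a + b >-> a + b}.
Proof. by move=> a b; apply/ffunP => g; rewrite !ffunE mulrDl. Qed.
HB.instance Definition _ := GRing.Zmodule_isLmodule.Build A crossed
  crossed_scaleA crossed_scale1 crossed_scaleDr crossed_scaleDl.

Fact crossed_scaleAl a x y : a *: (x * y) = (a *: x) * y.
Proof.
apply/ffunP => k; rewrite ffunE !crossed_mulE mulr_sumr.
by apply: eq_bigr => g _; rewrite ffunE !mulrA.
Qed.
HB.instance Definition _ := GRing.Lmodule_isLalgebra.Build A crossed
  crossed_scaleAl.

Definition crossedU g : crossed := [ffun h => if h == g then 1 else 0].

Lemma crossed_sum x : x = \sum_g x g *: crossedU g.
Proof.
apply/ffunP => k; rewrite sum_ffunE (bigD1 k) //= !ffunE eqxx mulr1.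
rewrite big1 ?addr0 // => g gk; rewrite !ffunE.
by rewrite eq_sym (negPf gk) mulr0.
Qed.

Lemma crossedU_mul a b g h :
  (a *: crossedU g) * (b *: crossedU h) =
  (a * sigma g b * f g h) *: crossedU (g * h)%g.
Proof.
apply/ffunP => k; rewrite crossed_mulE (bigD1 g) //= big1 ?addr0.
  rewrite !ffunE eqxx mulr1.
  have [->|kgh] := eqVneq k (g * h)%g; first by rewrite mulKg eqxx !mulr1.
  rewrite ifN ?mulr0 ?rmorph0 ?mulr0 ?mul0r //.
  by apply: contraNneq kgh => <-; rewrite mulKVg.
by move=> l /negPf lg; rewrite !ffunE lg mulr0 !mul0r.
Qed.
End CrossedProduct.

Section CrossedFraction.
Variables (S : idomainType) (gT : finGroupType) (sigma : ring_action gT S).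
Variable f : cocycle2 sigma.

Fact frac_cocycle_unit g h : (f g h)%:F \is a @GRing.unit {fraction S}.
Proof. exact/rmorph_unit/cocycle2_unit. Qed.
Fact frac_cocycleP g h k :
  (f g h)%:F * (f (g * h)%g k)%:F =
  frac_action sigma g (f h k)%:F * (f g (h * k)%g)%:F.
Proof. by rewrite frac_actionE -!tofracM cocycle2P. Qed.
Fact frac_cocycle_1g g : (f 1%g g)%:F = 1.
Proof. by rewrite cocycle2_1g tofrac1. Qed.
Fact frac_cocycle_g1 g : (f g 1%g)%:F = 1.
Proof. by rewrite cocycle2_g1 tofrac1. Qed.

(* f viewed in Z^2(G, L^* ), with L the quotient field of S. *)
Definition frac_cocycle : cocycle2 (frac_action sigma) :=
  @Cocycle2 gT {fraction S} (frac_action sigma) (fun g h => (f g h)%:F)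
    frac_cocycle_unit frac_cocycleP frac_cocycle_1g frac_cocycle_g1.

Definition crossed_incl (x : crossed_product f) : crossed_product frac_cocycle :=
  [ffun g => (x g)%:F].

Fact crossed_incl_is_zmod_morphism : zmod_morphism crossed_incl.
Proof. by move=> x y; apply/ffunP => g; rewrite !ffunE tofracB. Qed.
Fact crossed_incl_is_monoid_morphism : monoid_morphism crossed_incl.
Proof.
split=> [|x y]; apply/ffunP => k.
  by rewrite !ffunE; case: eqP; rewrite ?tofrac1 ?tofrac0.
rewrite ffunE !crossed_mulE rmorph_sum /=; apply: eq_bigr => g _.
by rewrite !ffunE frac_actionE !tofracM.
Qed.
HB.instance Definition _ := GRing.isZmodMorphism.Build _ _ crossed_incl
  crossed_incl_is_zmod_morphism.
HB.instance Definition _ := GRing.isMonoidMorphism.Build _ _ crossed_incl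
  crossed_incl_is_monoid_morphism.

Definition crossed_sub : {pred crossed_product frac_cocycle} :=
  [pred y | `[< exists x : crossed_product f, y = crossed_incl x >]].
End CrossedFraction.
Arguments crossed_sub {S gT sigma} f.

(* In this section R is a subring of a field L and A is an L-algebra on the
   left in which L need not be central (only the quotient field of R acts
   centrally).  The orders below are the R-orders of the algebra A over the
   quotient field of R. *)
Section Orders.
Variables (L : fieldType) (R : {pred L}) (A : lalgType L).

Definition fractions_in : {pred L} :=
  [pred k | `[< exists ab : L * L,
    [/\ ab.1 \in R, ab.2 \in R, ab.2 != 0 & k = ab.1 / ab.2] >]].

Definition in_span (C : {pred L}) (X : {pred A}) (x : A) : Prop :=
  exists s : seq (L * A),
    (forall p, p \in s -> p.1 \in C /\ p.2 \in X) /\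
    x = \sum_(p <- s) p.1 *: p.2.

Definition is_order (Gamma : {pred A}) : Prop :=
  [/\ GRing.subring_closed Gamma,
      exists gens : seq A,
        forall x : A, x \in Gamma <-> in_span R (mem gens) x &
      forall x : A, in_span fractions_in Gamma x].

Definition is_maximal_order (Gamma : {pred A}) : Prop :=
  is_order Gamma /\
  forall Delta : {pred A}, is_order Delta ->
    {subset Gamma <= Delta} -> {subset Delta <= Gamma}.
End Orders.

Section Hereditary.

Definition projective (B : nzRingType) (P : lmodType B) : Prop :=
  forall (M N : lmodType B) (p : {linear M -> N}) (u : {linear P -> N}),
    (forall y : N, exists x : M, p x = y) ->
    exists v : {linear P -> M}, forall x : P, p (v x) = u x.

(* J is the left ideal I as a B-module: a subtype of the regular module B^o on
   I whose inclusion is linear, which exists exactly when I is a left ideal. *)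
Definition left_hereditary (B : nzRingType) : Prop :=
  forall (I : {pred B^o}) (J : subLmodType I), projective J.

(* Right modules over B are left modules over the converse ring B^c. *)
Definition hereditary (B : nzRingType) : Prop :=
  left_hereditary B /\ left_hereditary B^c.
End Hereditary.

(* Main.v *)
(* Write k = S/(p) for a uniformizer p, I for the inertia group and N for the
   subgroup of I acting trivially on (p)/(p^2).  N contains the commutators of
   I, and an element of N of prime order l satisfies l = 0 in k.  If I is not
   abelian, some power c != 1 of a commutator has prime order l.  Since f^|I| is
   a coboundary over k, where I acts trivially, and l-power roots are unique in
   k, some monomial X = s U_c satisfies X^l = 1 over k.  By separability c fixes
   no uniformizer: otherwise (c z - z)/p^j would, for every j > 0 in turn, induce
   a derivation of k trivial on the image of R, hence zero.  So X^l, a scalar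
   fixed by c and congruent to 1 mod p, is congruent to 1 mod p^2.

   There is a proper two-sided ideal J containing p and X - 1: as N is an
   l-group, sum_h a_h U_h |-> sum_h a_h^|N| prod_(x in N) f(h,x) is a ring
   homomorphism from the twisted group ring of N over k to k, and it maps X to 1.
   If S^f*G is hereditary or a maximal order, then p = sum_i A_i a_i with a_i in
   J and (X - 1) A_i = 0 mod p.  Modulo p the annihilator of X - 1 is generated
   by nu = 1 + X + ... + X^(l-1), so p(1 - e) = nu z with e in J.  As
   (X - 1) nu = X^l - 1 lies in (p^2), multiplying by X - 1 yields
   (X - 1)(1 - e) = 0 mod p, so 1 - e lies in (nu, p), hence in J: a
   contradiction. *)

Require Import Defs.
From HB Require Import structures.
From mathcomp Require Import all_boot all_fingroup all_algebra all_solvable.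
From mathcomp Require Import separable generic_quotient boolp ring.

Set Implicit Arguments.
Unset Strict Implicit.
Unset Printing Implicit Defensive.

Import GRing.Theory.
Local Open Scope ring_scope.

(** * Uniformizers and ramification *)

Section Uniformizer.
Variable S : dvrType.
Implicit Types (p x y : S) (j : nat).

Definition pow_dvd p j x : Prop := exists d, x = p ^+ j * d.

Definition uniformizer p : Prop :=
  p != 0 /\ forall x, x \in maxideal S <-> pow_dvd p 1 x.

Lemma uniformizer_exists : exists p, uniformizer p.
Proof.
have [p pP] := dvr_principal _ (maxideal_closed S).
have dvdP x : x \in maxideal S <-> pow_dvd p 1 x.
  rewrite pP; split=> -[d ->]; exists d; first by rewrite mulrC.
  by rewrite mulrC.
exists p; split=> //; have [x [x0 xU]] := @dvr_nonfield S.
have /dvdP [d xE] : x \in maxideal S by [].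
by apply: contraNneq x0 => p0; rewrite xE p0 mul0r.
Qed.

Lemma pow_dvdD p j x y : pow_dvd p j x -> pow_dvd p j y -> pow_dvd p j (x + y).
Proof. by move=> [a ->] [b ->]; exists (a + b); rewrite mulrDr. Qed.
Lemma pow_dvdMl p j x y : pow_dvd p j x -> pow_dvd p j (y * x).
Proof. by move=> [a ->]; exists (y * a); rewrite mulrCA. Qed.
Lemma pow_dvdMr p j x y : pow_dvd p j x -> pow_dvd p j (x * y).
Proof. by move=> [a ->]; exists (a * y); rewrite mulrA. Qed.
Lemma pow_dvd0 p j : pow_dvd p j 0.
Proof. by exists 0; rewrite mulr0. Qed.

Variable p : S.
Hypothesis p_unif : uniformizer p.

Let p_neq0 : p != 0. Proof. by case: p_unif. Qed.

Lemma res_eq0P x : res x = 0 <-> pow_dvd p 1 x.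
Proof.
case: p_unif => _ <-; split=> [/eqP|xM]; first by rewrite res_eq0.
by apply/eqP; rewrite res_eq0.
Qed.

Lemma res_uniformizer : res p = 0.
Proof. by apply/res_eq0P; exists 1; rewrite mulr1. Qed.

Lemma pow_dvdSP j x : pow_dvd p j.+1 (p ^+ j * x) <-> res x = 0.
Proof.
rewrite res_eq0P; split=> -[d E]; exists d.
  apply: (mulfI (expf_neq0 j p_neq0)).
  by rewrite E exprSr mulrA.
by rewrite E expr1 exprSr mulrA.
Qed.

(** The intersection is principal, generated by some [a = p * b]. Cancelling [p] puts [b] in it too,
    so [b = y * a] and [a * (1 - p * y) = 0], while [p] is not a unit. *)
Lemma krull_intersection x : (forall j, pow_dvd p j x) -> x = 0.
Proof.
move=> xI; pose I : {pred S} := [pred x | `[< forall j, pow_dvd p j x >]].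
have I_closed : idealr_closed I.
  split; rewrite ?inE.
  - by apply/asboolP => j; apply: pow_dvd0.
  - apply/asboolP => /(_ 1) /res_eq0P /eqP.
    by rewrite rmorph1 oner_eq0.
  - move=> a u v; rewrite !inE => /asboolP uI /asboolP vI; apply/asboolP => j.
    by apply: pow_dvdD => //; apply: pow_dvdMl.
have [a aP] := dvr_principal _ I_closed.
have aI : forall j, pow_dvd p j a.
  by apply/asboolP; have /aP : exists y, a = y * a by exists 1; rewrite mul1r.
have [b aE] := aI 1; rewrite expr1 in aE.
have /aP [y bE] : b \in I.
  apply/asboolP => j; have [d] := aI j.+1.
  by rewrite aE exprS -mulrA => /(mulfI p_neq0) ->; exists d.
have : a * (1 - p * y) = 0.
  by rewrite {1}aE bE; rewrite mulrBr mulr1 -bE -aE {1}aE bE; ring.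
move/eqP; rewrite mulf_eq0 subr_eq0 => /orP [/eqP a0|/eqP py1].
  have /aP [z ->] : x \in I by apply/asboolP.
  by rewrite a0 mulr0.
have /res_eq0P/eqP : pow_dvd p 1 1 by exists y; rewrite expr1.
by rewrite rmorph1 oner_eq0.
Qed.

Lemma uniformizerMu u : u \is a GRing.unit -> uniformizer (p * u).
Proof.
move=> uU; split.
  by rewrite mulf_neq0 //; apply: contraTneq uU => ->; rewrite unitr0.
move=> x; case: p_unif => _ ->; split=> -[d ->].
  by exists (u^-1 * d); rewrite !expr1 -mulrA mulVKr.
by exists (u * d); rewrite !expr1 mulrA.
Qed.

End Uniformizer.

(** Applying [D] to [P(x) = 0], with [P] the minimal polynomial, gives [P'(x) * D x = 0], and
    [P'(x)] is nonzero by separability. *)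
Lemma separable_derivation0 (k : fieldType) (K : {pred k}) (D : k -> k) :
  separable_ext K -> {morph D : x y / x + y} ->
  (forall x y, D (x * y) = x * D y + D x * y) ->
  {in K, forall x, D x = 0} -> forall x, D x = 0.
Proof.
move=> sepK DD DM DK x; have [P [_ PK Px0 _] sepP] := sepK x.
have D0 : D 0 = 0 by apply: (addrI (D 0)); rewrite -DD !addr0.
have horner_D (Q : {poly k}) :
    (forall i, D Q`_i = 0) -> D Q.[x] = Q^`().[x] * D x.
  elim/poly_ind: Q => [|Q a IH] QK; first by rewrite deriv0 !horner0 D0 mul0r.
  rewrite hornerMXaddC DD DM IH => [|i]; last first.
    by have := QK i.+1; rewrite coefD coefMX coefC addr0.
  have -> : D a = 0 by have := QK 0; rewrite coefD coefMX coefC add0r.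
  by rewrite derivD derivC addr0 derivM derivX mulr1 !hornerE; ring.
have PD i : D P`_i = 0.
  have [iP|Pi] := ltnP i (size P); last by rewrite nth_default.
  by apply: DK; move/allP: PK; apply; rewrite mem_nth.
have := horner_D P PD; rewrite (rootP Px0) D0.
move/esym/eqP; rewrite mulf_eq0 => /orP [|/eqP //].
rewrite separable_poly.unlock in sepP.
by rewrite (negPf (coprimep_root sepP Px0)).
Qed.

(** * Inertia and wild inertia *)

Section Ramification.
Variables (S : dvrType) (gT : finGroupType) (sigma : ring_action gT S).
Implicit Types (g h : gT) (p x z : S).

Lemma inertiaP g :
  g \in inertia sigma <-> forall z : S, res (sigma g z) = res z.
Proof.
rewrite inE; split=> [/asboolP gI z|gI]; first by rewrite -res_actionE gI.
by apply/asboolP => x; rewrite -(res_surj x) res_actionE gI.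
Qed.

Lemma ract_invK g : cancel (sigma g^-1%g) (sigma g).
Proof. by move=> z; rewrite -ractM mulgV ract1. Qed.

Hypothesis faithful_sigma : faithful_action sigma.

Lemma ract_pow_dvd_trivial p g : uniformizer p ->
  (forall j z, pow_dvd p j (sigma g z - z)) -> g = 1%g.
Proof.
move=> p_unif gtriv; apply: faithful_sigma => z; apply/eqP.
by rewrite -subr_eq0; apply/eqP/(krull_intersection p_unif).
Qed.

(** If [sigma g z - z = p ^+ j.+1 * d z] for all [z], then [d] induces a derivation of the residue
    field that is zero on the image of the fixed ring. Separability makes it zero, so [p] divides
    every [d z] and [j] can be increased. *)
Lemma inertia_moves_uniformizer p g :
  separable_ext (residue_fixed sigma) -> uniformizer p ->
  g \in inertia sigma -> sigma g p = p -> g = 1%g.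
Proof.
move=> sep p_unif /inertiaP gI gp; apply: (ract_pow_dvd_trivial p_unif).
have p0 : p != 0 by case: p_unif.
case=> [z|j]; first by exists (sigma g z - z); rewrite mul1r.
elim: j => [z|j IH].
  by apply/(res_eq0P p_unif); rewrite rmorphB /= gI subrr.
have [d dE] := boolp.choice IH.
have pj0 : p ^+ j.+1 != 0 by rewrite expf_neq0.
have dD z w : d (z + w) = d z + d w.
  by apply: (mulfI pj0); rewrite mulrDr -!dE rmorphD /=; ring.
have dM z w : d (z * w) = sigma g z * d w + d z * w.
  apply: (mulfI pj0); rewrite -dE mulrDr (mulrCA _ (sigma g z)) -dE mulrA -dE rmorphM /=.
  by ring.
(* Here [g] fixing [p] enters: [d] preserves multiples of [p], hence descends to the residue
   field. *)
have dp z : d (p * z) = p * d z.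
  by apply: (mulfI pj0); rewrite -dE mulrCA -dE rmorphM /= gp mulrBr.
have d0 : d 0 = 0 by apply: (addrI (d 0)); rewrite -dD !addr0.
have dN z : d (- z) = - d z.
  by apply: (addrI (d z)); rewrite -dD !subrr.
have d_res z w : res z = res w -> res (d z) = res (d w).
  move=> /eqP; rewrite -subr_eq0 -rmorphB => /eqP /(res_eq0P p_unif) [e].
  rewrite expr1 => zw; apply/eqP; rewrite -subr_eq0 -rmorphB -dN -dD zw dp /=.
  by rewrite rmorphM /= (res_uniformizer p_unif) mul0r.
pose D (x : residue S) := res (d (repr x)).
have Dres z : D (res z) = res (d z) by apply: d_res; rewrite res_surj.
have D0 : forall u, D u = 0.
  apply: (separable_derivation0 sep).
  - move=> u v; rewrite -(res_surj u) -(res_surj v) -rmorphD !Dres dD.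
    by rewrite rmorphD.
  - move=> u v; rewrite -(res_surj u) -(res_surj v) -rmorphM !Dres dM.
    by rewrite rmorphD !rmorphM /= gI.
  - move=> u /asboolP [r rR ->]; rewrite Dres.
    have -> : d r = 0; last exact: rmorph0.
    apply: (mulfI pj0); rewrite -dE mulr0.
    by move: rR; rewrite inE => /forallP /(_ g) /eqP ->; rewrite subrr.
by move=> z; rewrite dE; apply/(pow_dvdSP p_unif); rewrite -Dres.
Qed.

Variable p : S.
Hypothesis p_unif : uniformizer p.

(** [j = 0] is inertia and [j = 1] is triviality on [(p)/(p^2)]; together they imply the other
    cases, which the induction in [wild_inertia_order] uses. *)
Definition wild_inertia : {set gT} :=
  [set g | `[< forall j z,
     pow_dvd p j.+1 (sigma g (p ^+ j * z) - p ^+ j * z) >]].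

Lemma pow_dvd_ract j g z : pow_dvd p j z -> pow_dvd p j (sigma g z).
Proof.
move=> [d ->]; rewrite rmorphM rmorphXn /=; apply: pow_dvdMr.
have : p \in maxideal S by apply/(p_unif.2 _); exists 1; rewrite mulr1.
rewrite -(ract_maxideal sigma g) => /(p_unif.2 _) [e ->].
by exists (e ^+ j); rewrite expr1 exprMn.
Qed.

Lemma wild_inertiaP g : g \in wild_inertia <->
  forall j z, pow_dvd p j.+1 (sigma g (p ^+ j * z) - p ^+ j * z).
Proof. by rewrite inE; split=> /asboolP. Qed.

Lemma wild_inertia_group_set : group_set wild_inertia.
Proof.
apply/group_setP; split=> [|g h /wild_inertiaP gN /wild_inertiaP hN].
  by apply/wild_inertiaP => j z; rewrite ract1 subrr; apply: pow_dvd0.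
apply/wild_inertiaP => j z; rewrite ractM.
rewrite -[X in pow_dvd _ _ X](subrKA (sigma g (p ^+ j * z))).
by apply: pow_dvdD => //; rewrite -rmorphB; apply: pow_dvd_ract.
Qed.
Canonical wild_inertia_group := Group wild_inertia_group_set.

Lemma wild_inertia_conj g h : g \in wild_inertia -> (g ^ h)%g \in wild_inertia.
Proof.
move=> /wild_inertiaP gN; apply/wild_inertiaP => j z.
have [d dE] : pow_dvd p j (sigma h (p ^+ j * z)).
  by apply: pow_dvd_ract; exists z.
rewrite conjgE !ractM dE -[X in _ - X](ractK sigma h) dE -rmorphB.
exact: pow_dvd_ract.
Qed.

Lemma wild_sub_inertia g : g \in wild_inertia -> g \in inertia sigma.
Proof.
move=> /wild_inertiaP gN; apply/inertiaP => z; have := gN 0%N z.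
by rewrite !mul1r => /(res_eq0P p_unif) /eqP; rewrite rmorphB subr_eq0 => /eqP.
Qed.

(** Inertia allows [z] to be split off, which leaves the powers of [p], treated by induction on
    [j]. *)
Lemma wild_inertia_uniformizer g : g \in inertia sigma ->
  pow_dvd p 2 (sigma g p - p) -> g \in wild_inertia.
Proof.
move=> gI gp; apply/wild_inertiaP => j z.
suff gpj : pow_dvd p j.+1 (sigma g (p ^+ j) - p ^+ j).
  rewrite rmorphM /= -[X in pow_dvd _ _ X](subrKA (p ^+ j * sigma g z)).
  apply: pow_dvdD; first by rewrite -mulrBl; apply: pow_dvdMr.
  rewrite -mulrBr; apply/(pow_dvdSP p_unif).
  by rewrite rmorphB /= (inertiaP g).1 ?subrr.
elim: j => [|j [d IH]]; first by rewrite rmorph1 subrr; apply: pow_dvd0.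
have [e eE] := gp; move/eqP: eE; rewrite subr_eq => /eqP eE.
move/eqP: IH; rewrite subr_eq => /eqP IH.
rewrite exprS rmorphM /= IH eE.
by exists (e + d + p * e * d); rewrite !exprS expr0; ring.
Qed.

(** The residue of [sigma g p / p] is a multiplicative character of the inertia group, so it is
    trivial on commutators. *)
Lemma inertia_commg_wild g h : g \in inertia sigma -> h \in inertia sigma ->
  [~ g, h]%g \in wild_inertia.
Proof.
move=> /[dup] gI /inertiaP gIP /[dup] hI /inertiaP hIP.
have pp : pow_dvd p 1 p by exists 1; rewrite mulr1.
have [a] := pow_dvd_ract g pp; rewrite expr1 => gp.
have [b] := pow_dvd_ract h pp; rewrite expr1 => hp.
apply: wild_inertia_uniformizer.
  apply/inertiaP => z; rewrite commgEl conjgE !ractM.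
  have invI u : u \in inertia sigma -> forall w, res (sigma u^-1%g w) = res w.
    by move=> /inertiaP uI w; rewrite -uI ract_invK.
  by rewrite invI // invI // gIP hIP.
(* Applying [h * g] reduces the claim to comparing the images of [p] under [g * h] and [h * g]. *)
rewrite -[X in pow_dvd _ _ X](ractK sigma (h * g)%g); apply: pow_dvd_ract.
rewrite rmorphB /= -ractM -commgC !ractM hp gp !rmorphM /= gp hp.
have -> : p * a * sigma g b - p * b * sigma h a
  = p ^+ 1 * (a * sigma g b - b * sigma h a) by rewrite expr1; ring.
apply/(pow_dvdSP p_unif); rewrite rmorphB !rmorphM /= gIP hIP.
by rewrite mulrC subrr.
Qed.

(** Let [n] be the order of [g]. If [g z = z + p^j d], then wildness gives [g^i z = z + i p^j d]
    modulo [p^(j+1)], and [i = n] puts [n d] in [(p)]. With [n] invertible, [g] would be trivial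
    modulo every power of [p]. *)
Lemma wild_inertia_order g : g \in wild_inertia -> g != 1%g ->
  (#[g]%g)%:R = 0 :> residue S.
Proof.
move=> /[dup] gN /wild_inertiaP gNP; apply: contraNeq => n0; apply/eqP.
apply: (ract_pow_dvd_trivial p_unif); elim=> [|j IH] z.
  by exists (sigma g z - z); rewrite mul1r.
have [d dE] := IH z; rewrite dE; apply/(pow_dvdSP p_unif).
have gn i : pow_dvd p j.+1 (sigma (g ^+ i)%g z - (z + (p ^+ j * d) *+ i)).
  elim: i => [|i IHi]; first by rewrite ract1 addr0 subrr; apply: pow_dvd0.
  rewrite expgS ractM.
  have -> : sigma g (sigma (g ^+ i)%g z) - (z + p ^+ j * d *+ i.+1) =
     sigma g (sigma (g ^+ i)%g z - (z + p ^+ j * d *+ i)) +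
     (sigma g (p ^+ j * d) - p ^+ j * d) *+ i.
    rewrite rmorphB rmorphD rmorphMn /= mulrnBl mulrS -dE.
    by rewrite -[_ *+ i]mulr_natr -[sigma g (_ - _) *+ i]mulr_natr; ring.
  apply: pow_dvdD; first exact: pow_dvd_ract.
  by rewrite -mulr_natl; apply: pow_dvdMl.
have := gn #[g]%g; rewrite expg_order ract1 opprD addNKr -mulrnAr -mulrN.
move/(pow_dvdSP p_unif)/eqP; rewrite rmorphN oppr_eq0 rmorphMn -mulr_natl mulf_eq0.
by rewrite (negPf n0) => /eqP.
Qed.

End Ramification.

(** * Twisted group rings *)

Section CrossedMonomials.
Variables (gT : finGroupType) (A : comUnitRingType) (sigma : ring_action gT A).
Variable f : cocycle2 sigma.
Implicit Types (g h c : gT) (a b s : A) (x y : crossed_product f).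
Local Notation "'U_ g" := (crossedU f g) (at level 8, g at level 2).

Lemma crossedU1 : 'U_ 1%g = 1.
Proof. by apply/ffunP => g; rewrite !ffunE. Qed.

Lemma crossed_scaleE a x g : (a *: x) g = a * x g.
Proof. by rewrite ffunE. Qed.

Lemma crossed_addE x y g : (x + y) g = x g + y g.
Proof. by rewrite ffunE. Qed.

Lemma crossed_monomial_mulE a h x g :
  ((a *: 'U_ h) * x) g = a * sigma h (x (h^-1 * g)%g) * f h (h^-1 * g)%g.
Proof.
rewrite [LHS]crossed_mulE (bigD1 h) //= big1 ?addr0 => [|l /negPf lh].
  by rewrite !ffunE eqxx mulr1.
by rewrite !ffunE lh mulr0 !mul0r.
Qed.

Lemma crossed_mul_monomialE a h x g :
  (x * (a *: 'U_ h)) g =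
  x (g * h^-1)%g * sigma (g * h^-1)%g a * f (g * h^-1)%g h.
Proof.
have gh : ((g * h^-1)^-1 * g = h)%g by rewrite invMg invgK -mulgA mulVg mulg1.
rewrite [LHS]crossed_mulE (bigD1 (g * h^-1)%g) //= big1 ?addr0 => [|l lgh].
  by rewrite gh !ffunE eqxx mulr1.
rewrite !ffunE ifN ?mulr0 ?rmorph0 ?mulr0 ?mul0r //.
by apply: contraNneq lgh => <-; rewrite invMg invgK mulKVg.
Qed.

Lemma crossed_monomial_mulZ a h b x :
  (a *: 'U_ h) * (b *: x) = sigma h b *: ((a *: 'U_ h) * x).
Proof.
apply/ffunP => g; rewrite crossed_scaleE !crossed_monomial_mulE crossed_scaleE.
by rewrite rmorphM /=; ring.
Qed.

Lemma crossedU_linv h : exists y, y * 'U_ h = 1.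
Proof.
exists ((f h^-1%g h)^-1 *: 'U_ h^-1%g).
have := crossedU_mul f (f h^-1%g h)^-1 1 h^-1%g h.
by rewrite rmorph1 mulr1 mulVr ?cocycle2_unit // !scale1r mulVg crossedU1.
Qed.

(* Left multiplication by the monomial permutes the coordinates along the
   cosets of <[c]>, so a fixed vector is determined by its coordinates on a
   transversal. *)
Lemma crossed_monomial_fixed s c x :
  (s *: 'U_ c) * x = x ->
  exists y, x = (\sum_(i < #[c]%g) (s *: 'U_ c) ^+ i) * y.
Proof.
set X := s *: 'U_ c => Xx; pose t g := fingroup.repr (<[c]>%g :* g)%g.
pose y : crossed_product f := [ffun g => if g == t g then x g else 0].
exists y; rewrite mulr_suml; apply/ffunP => g; rewrite sum_ffunE.
have Xxi i : X ^+ i * x = x.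
  by elim: i => [|i IH]; rewrite ?mul1r // exprSr -mulrA Xx.
have Xi i : exists a, X ^+ i = a *: 'U_ (c ^+ i)%g.
  elim: i => [|i [a IH]]; first by exists 1; rewrite scale1r crossedU1.
  by rewrite exprS IH crossedU_mul -expgS; eexists.
have Xyi i : (X ^+ i * y) g = if (c ^- i * g)%g == t g then x g else 0.
  have [a aE] := Xi i; have := congr1 (fun z : crossed_product f => z g) (Xxi i).
  rewrite /= aE !crossed_monomial_mulE ffunE => <-.
  have -> : t (c ^- i * g)%g = t g.
    by congr fingroup.repr; apply: rcoset_eqP; rewrite mem_rcoset mulgK groupV mem_cycle.
  by case: ifP; rewrite // rmorph0 mulr0 mul0r.
under eq_bigr => i _ do rewrite Xyi.
have /rcosetP [_ /cycleP [j ->] tE] : t g \in (<[c]> :* g)%g.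
  exact: mem_repr (rcoset_refl _ _).
have tEi i : (c ^- i * g == t g)%g = (#[c]%g %| i + j)%N.
  by rewrite tE (inj_eq (mulIg g)) eq_invg_mul -expgD order_dvdn.
(* [i0] is [- j] modulo the order of [c], the only exponent that carries [g] to its representative
   [t g]. *)
pose i0 := Ordinal (ltn_pmod (#[c]%g - j %% #[c]%g)%N (order_gt0 c)).
have i0j : (#[c]%g %| i0 + j)%N.
  rewrite /dvdn modnDml -modnDmr subnK ?modnn //.
  exact/ltnW/ltn_pmod/order_gt0.
rewrite (bigD1 i0) //= big1 ?addr0 => [|i i0i]; rewrite tEi ?i0j //.
case: ifP => // ij; case/eqP: i0i; apply: val_inj.
rewrite -[LHS](modn_small (ltn_ord i)) -[RHS](modn_small (ltn_ord i0)).
apply/eqP; rewrite -(eqn_modDr j).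
by move: ij i0j; rewrite /dvdn => /eqP -> /eqP ->.
Qed.

End CrossedMonomials.

(** * Cocycles on a subgroup acting trivially *)

Section TwistedSubgroup.
Variables (gT : finGroupType) (k : fieldType) (sigma : ring_action gT k).
Variable f : cocycle2 sigma.
Variable H : {group gT}.
Hypothesis Htriv : forall g, g \in H -> forall a, sigma g a = a.
Implicit Types (g h c : gT) (a b s : k) (x y : crossed_product f).
Local Notation "'U_ g" := (crossedU f g) (at level 8, g at level 2).

(* The cochain whose coboundary is f^|H|. *)
Definition cocycle_prod g : k := \prod_(x in H) f g x.

Lemma cocycle_neq0 g h : f g h != 0.
Proof. by rewrite -unitfE cocycle2_unit. Qed.

Lemma cocycle_prod_neq0 g : cocycle_prod g != 0.
Proof. by rewrite prodf_seq_neq0; apply/allP => x _; rewrite cocycle_neq0 implybT. Qed.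

Lemma cocycle_prod1 : cocycle_prod 1%g = 1.
Proof. by rewrite /cocycle_prod big1 // => x _; rewrite cocycle2_1g. Qed.

(** Multiply the cocycle identity at [(g, h, x)] over [x] in [H]. Thus [a U_g] maps to
    [a ^+ #|H| * cocycle_prod g] multiplicatively on monomials over [H]. *)
Lemma cocycle_prodM g h : g \in H -> h \in H ->
  f g h ^+ #|H| * cocycle_prod (g * h)%g = cocycle_prod g * cocycle_prod h.
Proof.
move=> gH hH; rewrite [cocycle_prod g](reindex_inj (mulgI h)) /=.
under [X in _ = X * _]eq_bigl => x do rewrite groupMl //.
rewrite -prodr_const -!big_split /=; apply: eq_bigr => x xH.
by rewrite cocycle2P Htriv // mulrC.
Qed.

(** [cocycle_prod] is multiplicative up to [#|H|]-th powers, and its values commute. *)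
Lemma cocycle_prod_commg g h : g \in H -> h \in H ->
  exists2 a, a != 0 & a ^+ #|H| * cocycle_prod [~ g, h]%g = 1.
Proof.
move=> gH hH.
have cH : [~ g, h]%g \in H by rewrite groupR.
have E1 := cocycle_prodM (groupM hH gH) cH; rewrite -commgC in E1.
have E2 := cocycle_prodM gH hH; have E3 := cocycle_prodM hH gH.
pose u := f (h * g)%g [~ g, h]%g.
(* With this scalar [a], [a U_[g,h]] is the multiplicative commutator of [U_g] and [U_h]. *)
exists (f g h / (u * f h g)).
  by rewrite mulf_neq0 ?invr_neq0 ?mulf_neq0 ?cocycle_neq0.
have [n1 n2] := (cocycle_prod_neq0 (h * g)%g, cocycle_prod_neq0 (g * h)%g).
have [u0 hg0] : u != 0 /\ f h g != 0 by rewrite !cocycle_neq0.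
have E4 : f h g ^+ #|H| * cocycle_prod (h * g)%g =
          f g h ^+ #|H| * cocycle_prod (g * h)%g by rewrite E2 E3 mulrC.
rewrite -/u in E1.
have um : u ^+ #|H| != 0 by rewrite expf_neq0.
have hgm : f h g ^+ #|H| != 0 by rewrite expf_neq0.
rewrite exprMn exprVn exprMn.
have -> : cocycle_prod [~ g, h]%g =
    u ^+ #|H| * cocycle_prod (g * h)%g / cocycle_prod (h * g)%g.
  by rewrite E1 mulrAC mulfV // mul1r.
have -> : cocycle_prod (h * g)%g =
    f g h ^+ #|H| * cocycle_prod (g * h)%g / f h g ^+ #|H|.
  by rewrite -E4 mulrAC mulfV // mul1r.
have ghm : f g h ^+ #|H| != 0 by rewrite expf_neq0 ?cocycle_neq0.
by field; rewrite um hgm ghm n2.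
Qed.

Lemma exprZ_crossedU s g i : g \in H -> (s *: 'U_ g) ^+ i = s ^+ i *: 'U_ g ^+ i.
Proof.
move=> gH; elim: i => [|i IH]; first by rewrite !expr0 scale1r.
rewrite exprS IH crossed_monomial_mulZ Htriv // -scalerAl -exprS scalerA.
by rewrite -exprSr.
Qed.

Lemma exprU_cocycle_prod g i : g \in H -> exists2 b, 'U_ g ^+ i = b *: 'U_ (g ^+ i)%g &
  b ^+ #|H| * cocycle_prod (g ^+ i)%g = cocycle_prod g ^+ i.
Proof.
move=> gH; elim: i => [|i [b bE bP]].
  exists 1; first by rewrite crossedU1 scale1r.
  by rewrite expr1n mul1r cocycle_prod1.
exists (b * f g (g ^+ i)%g).
  have := crossedU_mul f 1 b g (g ^+ i)%g.
  by rewrite exprS bE scale1r Htriv // mul1r -expgS.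
rewrite exprMn -mulrA expgS cocycle_prodM ?groupX //.
by rewrite mulrCA bP exprS.
Qed.

Section PChar.
Variable p : nat.
Hypothesis pk : p \in [pchar k].

Lemma expf_pchar_eq1 a e : a ^+ (p ^ e) = 1 -> a = 1.
Proof.
have p_nat : [pchar k].-nat (p ^ e)%N.
  by rewrite pnatX (eq_pnat _ (pcharf_eq pk)) pnat_id ?(pcharf_prime pk).
move=> a1; apply/eqP; rewrite -subr_eq0.
have : (a - 1) ^+ (p ^ e) == 0.
  have := exprDn_pchar (a - 1) 1 p_nat; rewrite subrK a1 expr1n => /eqP.
  by rewrite -subr_eq subrr eq_sym.
by rewrite expf_eq0 => /andP [].
Qed.

(** The scalar [b = (a U_g)^p] has [#|H|]-th power 1. As 1 is the only [p]-power root of 1, the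
    order of [b] is prime to [p], so the inverse of [b] is a [p]-th power and can be absorbed into
    [a]. *)
Lemma crossed_monomial_pth_root g a : g \in H -> #[g]%g = p -> a != 0 ->
  a ^+ #|H| * cocycle_prod g = 1 ->
  exists2 s, s != 0 & (s *: 'U_ g) ^+ p = 1.
Proof.
move=> gH gp a0 ag; have p_pr := pcharf_prime pk.
have [n nE nP] := exprU_cocycle_prod p gH.
have gp1 : (g ^+ p = 1)%g by rewrite -gp expg_order.
rewrite gp1 crossedU1 in nE; rewrite gp1 cocycle_prod1 mulr1 in nP.
pose b := a ^+ p * n; pose m := (#|H|`_p^')%N.
have bm : b ^+ m = 1.
  apply: (@expf_pchar_eq1 _ (logn p #|H|)).
  rewrite -exprM -p_part mulnC partnC ?cardG_gt0 // /b exprMn nP.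
  by rewrite -exprM mulnC exprM -exprMn ag expr1n.
have m_gt0 : (0 < m)%N by apply: part_gt0.
have pm : coprime p m by rewrite prime_coprime // -p'natE // part_pnat.
(* [r] is 0 modulo [p] and -1 modulo [m], so [b ^+ r] is a [p]-th power and the inverse of [b]. *)
pose r := chinese p m 0 m.-1.
have /dvdnP [u rE] : (p %| r)%N by rewrite /dvdn chinese_modl // mod0n.
have /dvdnP [v vE] : (m %| r.+1)%N.
  by rewrite /dvdn -addn1 -modnDml chinese_modr // modnDml addn1 prednK // modnn.
exists (a * b ^+ u).
  have n0 : n != 0.
    have := expf_neq0 p (cocycle_prod_neq0 g).
    by rewrite -nP expf_eq0 cardG_gt0.
  by rewrite mulf_neq0 // expf_neq0 // mulf_neq0 // expf_neq0.
rewrite exprZ_crossedU // nE scalerA exprMn -exprM -rE.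
rewrite mulrAC -[a ^+ p * n]/b -exprS vE mulnC exprM bm expr1n scale1r //.
Qed.

End PChar.
End TwistedSubgroup.

(** * A character of the twisted group ring in characteristic p *)

Section FrobeniusCharacter.
Variables (gT : finGroupType) (k : fieldType) (sigma : ring_action gT k).
Variables (f : cocycle2 sigma) (N : {group gT}) (p : nat).
Hypotheses (Ntriv : forall g, g \in N -> forall a, sigma g a = a).
Hypotheses (pk : p \in [pchar k]) (pN : (p.-group N)%g).
Implicit Types (g h c : gT) (a b s : k) (x y z : crossed_product f).
Local Notation "'U_ g" := (crossedU f g) (at level 8, g at level 2).

Definition frob_char x : k := \sum_(h in N) x h ^+ #|N| * cocycle_prod f N h.

Lemma pchar_nat_cardN : [pchar k].-nat #|N|.
Proof. by rewrite (eq_pnat _ (pcharf_eq pk)). Qed.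

Lemma exprN_sum (I : finType) (P : pred I) (F : I -> k) :
  (\sum_(i | P i) F i) ^+ #|N| = \sum_(i | P i) F i ^+ #|N|.
Proof.
apply: (big_morph (fun a => a ^+ #|N|)) => [a b|]; last first.
  by rewrite expr0n -[_ == _]negbK -lt0n cardG_gt0.
by rewrite exprDn_pchar ?pchar_nat_cardN.
Qed.

Lemma frob_charD x y : frob_char (x + y) = frob_char x + frob_char y.
Proof.
rewrite -big_split /=; apply: eq_bigr => h _.
by rewrite crossed_addE exprDn_pchar ?pchar_nat_cardN // mulrDl.
Qed.

Lemma frob_char0 : frob_char 0 = 0.
Proof. by apply: (addrI (frob_char 0)); rewrite -frob_charD !addr0. Qed.

Lemma frob_charN x : frob_char (- x) = - frob_char x.
Proof. by apply: (addrI (frob_char x)); rewrite -frob_charD !subrr frob_char0. Qed.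

Lemma frob_char1 : frob_char 1 = 1.
Proof.
rewrite /frob_char (bigD1 1%g) //= big1 => [|h /andP [_ /negPf h1]].
  by rewrite ffunE eqxx expr1n mul1r cocycle_prod1 addr0.
by rewrite ffunE h1 expr0n -[_ == 0%N]negbK -lt0n cardG_gt0 mul0r.
Qed.

(** Since [y] lives on [N], coordinates of [x] outside [N] do not reach those of [x * y] in [N].
    There [#|N|]-th powers are additive and [cocycle_prodM] applies termwise. *)
Lemma frob_charM x y : (forall h, h \notin N -> y h = 0) ->
  frob_char (x * y) = frob_char x * frob_char y.
Proof.
move=> yN; rewrite /frob_char.
transitivity (\sum_(h in N) \sum_(g in N)
   (x g ^+ #|N| * cocycle_prod f N g) *
   (y (g^-1 * h)%g ^+ #|N| * cocycle_prod f N (g^-1 * h)%g)).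
  apply: eq_bigr => h hN.
  have -> : (x * y) h = \sum_(g in N) x g * y (g^-1 * h)%g * f g (g^-1 * h)%g.
    rewrite [LHS]crossed_mulE [LHS](bigID [in N]) /= [X in _ + X]big1 ?addr0.
      by apply: eq_bigr => g gN; rewrite Ntriv.
    move=> g gN; rewrite yN ?rmorph0 ?mulr0 ?mul0r //.
    by rewrite groupMr // groupV.
  rewrite exprN_sum mulr_suml; apply: eq_bigr => g gN.
  have ghN : (g^-1 * h)%g \in N by rewrite groupMl ?groupV.
  have := cocycle_prodM f Ntriv gN ghN; rewrite mulKVg => E.
  rewrite 2!exprMn -(mulrA _ (f g _ ^+ _) (cocycle_prod f N h)) E.
  by rewrite mulrACA mulrA.
rewrite exchange_big mulr_suml /=; apply: eq_bigr => g gN.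
rewrite mulr_sumr [LHS](reindex_inj (mulgI g)) /=.
by apply: eq_big => [h|h hN]; rewrite ?groupMl ?mulKg.
Qed.

(* The largest two-sided ideal on which the component along N lies in the
   kernel of [frob_char]. *)
Definition frob_ideal x : Prop := forall u v, frob_char (u * x * v) = 0.

Lemma frob_idealD x y : frob_ideal x -> frob_ideal y -> frob_ideal (x + y).
Proof.
by move=> xJ yJ a b; rewrite mulrDr mulrDl frob_charD xJ yJ addr0.
Qed.
Lemma frob_idealM x y z : frob_ideal x -> frob_ideal (y * x * z).
Proof. by move=> xJ u v; have := xJ (u * y) (z * v); rewrite !mulrA. Qed.
Lemma frob_ideal0 : frob_ideal 0.
Proof. by move=> a b; rewrite mulr0 mul0r frob_char0. Qed.
Lemma frob_ideal1 : ~ frob_ideal 1.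
Proof. by move/(_ 1 1)/eqP; rewrite !mulr1 frob_char1 oner_eq0. Qed.

Hypothesis N_norm : forall g h, g \in N -> (g ^ h)%g \in N.

(** Moving [t U_h] to the left turns [X = s U_c] into a monomial [X'] at [c ^ h], again with [p]-th
    power 1. Its character is a [p]-th root of unity, hence 1, so [X' - 1] is killed. *)
Lemma frob_ideal_monomial s c : c \in N -> (s *: 'U_ c) ^+ p = 1 ->
  frob_ideal (s *: 'U_ c - 1).
Proof.
move=> cN Xp a b; rewrite (crossed_sum b) mulr_sumr.
rewrite (big_morph frob_char frob_charD frob_char0) big1 // => h _.
set t := b h; set X := s *: 'U_ c.
(* Solved from [X * U_h = U_h * X']. *)
pose s' := sigma h^-1%g (s * f c h / f h (c ^ h)%g).
pose X' := s' *: 'U_ (c ^ h)%g.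
have XU r : X * (r *: 'U_ h) = (r *: 'U_ h) * X'.
  rewrite !crossedU_mul Ntriv // /s' -ractM mulgV ract1.
  by rewrite -conjgC mulrA divfK ?cocycle_neq0 //; congr (_ *: _); ring.
have X'N g : g \notin N -> X' g = 0.
  move=> gN; rewrite !ffunE ifN ?mulr0 //.
  by apply: contraNneq gN => ->; apply: N_norm.
have XiN i g : g \notin N -> (X' ^+ i) g = 0.
  elim: i g => [|i IH] g gN.
    by rewrite ffunE ifN //; apply: contraNneq gN => ->.
  rewrite exprS crossed_monomial_mulE IH ?rmorph0 ?mulr0 ?mul0r //.
  by rewrite groupMl // groupV N_norm.
have X'p : X' ^+ p = 1.
  have [V VU] := crossedU_linv f h; have XUi i : X ^+ i * 'U_ h = 'U_ h * X' ^+ i.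
    elim: i => [|i IH]; first by rewrite mul1r mulr1.
    by have := XU 1; rewrite scale1r exprSr -mulrA => ->; rewrite mulrA IH -mulrA -exprSr.
  by have := XUi p; rewrite Xp mul1r => /(congr1 ( *%R V)); rewrite mulrA VU mul1r.
have frobX' : frob_char X' = 1.
  apply: (@expf_pchar_eq1 _ _ pk _ 1); rewrite expn1 -frob_char1 -X'p.
  elim: p => [|i IH]; first by rewrite frob_char1.
  by rewrite !exprSr IH frob_charM.
have -> : a * (X - 1) * (t *: 'U_ h) = a * (t *: 'U_ h) * (X' - 1).
  by rewrite -!mulrA; congr (_ * _); rewrite mulrBl mulrBr mul1r mulr1 XU.
rewrite frob_charM; last first.
  move=> g gN; rewrite crossed_addE X'N //.
  by rewrite add0r !ffunE ifN ?oppr0 //; apply: contraNneq gN => ->.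
by rewrite frob_charD frob_charN frobX' frob_char1 subrr mulr0.
Qed.

End FrobeniusCharacter.

(** * Left annihilators of right ideals *)

Section CrossedFrobenius.
Variables (gT : finGroupType) (k : fieldType) (sigma : ring_action gT k).
Variable f : cocycle2 sigma.
Implicit Types (x y z : crossed_product f).

(* A proper subspace of a coordinate space lies in the kernel of a nonzero
   functional: take T maximal such that no nonzero vector of W is supported on
   T; the coordinate form at a point of T, along W, is well defined. *)
Lemma proper_subspace_functional (I : finType) (W : (I -> k) -> Prop) (i0 : I) :
  (forall u v, u =1 v -> W u -> W v) ->
  (forall a u v, W u -> W v -> W (fun i => a * u i + v i)) ->
  ~ W (fun i => (i == i0)%:R) ->
  exists2 l : I -> k, (exists i, l i != 0) &
    forall u, W u -> \sum_i l i * u i = 0.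
Proof.
move=> Wext Wlin We.
pose indep (T : {set I}) := `[< forall u, W u -> (forall i, i \notin T -> u i = 0) ->
  forall i, u i = 0 >].
have [W0|W0] := pselect (W (fun=> 0)); last first.
  exists (fun=> 1) => [|u Wu]; first by exists i0; rewrite oner_neq0.
  by case: W0; apply: Wext (Wlin (-1) u u Wu Wu) => i; rewrite mulN1r addNr.
have ind0 : indep [set i0].
  apply/asboolP => u Wu u0 i; have [->|ii0] := eqVneq i i0; last first.
    by rewrite u0 // inE.
  apply: contra_notP We => /eqP ui0.
  apply: Wext (Wlin (u i0)^-1 u _ Wu W0) => j; rewrite addr0.
  have [->|ji0] := eqVneq j i0; first by rewrite mulVf.
  by rewrite (u0 j) ?inE ?ji0 // mulr0.
have [T /maxsetP [/asboolP Tind Tmax] i0T] := maxset_exists ind0.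
rewrite sub1set in i0T.
(* By maximality of [T], each [j] outside it has a vector of [W] equal to 1 at [j] and 0 at the
   other points outside [T]. *)
have Tw j : exists w, j \notin T -> [/\ W w, w j = 1 &
    forall i, i \notin T -> i != j -> w i = 0].
  have [jT|jT] := boolP (j \in T); first by exists (fun=> 0).
  have : ~ indep (j |: T).
    move=> jTind; have := Tmax _ jTind (subsetUr _ _) => /setP /(_ j).
    by rewrite !inE eqxx (negPf jT).
  move=> /negP /asboolPn /existsNP [u] /not_implyP [Wu] /not_implyP [uS] /existsNP [i ui].
  have uj : u j != 0.
    apply/eqP => uj; apply: ui; apply: Tind => // l lT.
    have [->//|lj] := eqVneq l j; apply: uS.
    by rewrite !inE negb_or lj lT.
  exists (fun i => (u j)^-1 * u i + 0) => _; split; first exact: Wlin.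
    by rewrite addr0 mulVf.
  move=> l lT lj; have -> : u l = 0 by apply: uS; rewrite !inE negb_or lj.
  by rewrite mulr0 addr0.
have [w wP] := boolp.choice Tw.
(* Modulo [W], the basis vector at [i] outside [T] equals a vector supported on [T], whose
   coordinate at [i0] is [- w i i0]. *)
exists (fun i => if i \in T then (i == i0)%:R else - w i i0).
  by exists i0; rewrite i0T eqxx oner_neq0.
(* [v] lies in [W] and on [T], hence is zero; its coordinate at [i0] is the functional at [u]. *)
move=> u Wu; pose v i := u i - \sum_(j | j \notin T) u j * w j i.
have Wv : W v.
  suff Ws (r : seq I) : W (fun i => u i - \sum_(j <- r | j \notin T) u j * w j i).
    by apply: Wext (Ws (index_enum I)).
  elim: r => [|j r IH]; first by apply: Wext Wu => i; rewrite big_nil subr0.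
  have [jT|jT] := boolP (j \in T).
    by apply: Wext IH => i; rewrite big_cons jT.
  have [Ww _ _] := wP j jT.
  by apply: Wext (Wlin (- u j) _ _ Ww IH) => i; rewrite big_cons jT; ring.
have v0 i : i \notin T -> v i = 0.
  move=> iT; rewrite /v (bigD1 i) //= big1 => [|j /andP [jT ji]].
    by have [_ -> _] := wP i iT; rewrite mulr1 addr0 subrr.
  by have [_ _ ->] := wP j jT; rewrite ?mulr0 // eq_sym.
have := Tind v Wv v0 i0; rewrite /v => {v0 Wv v}.
rewrite [in X in _ -> X](bigID [in T]) /= [in X in _ -> X](bigD1 i0) //= i0T eqxx mul1r.
rewrite [X in _ -> _ + X + _ = _]big1 => [|i /andP [iT /negPf ii0]]; last first.
  by rewrite iT ii0 mul0r.
rewrite addr0 => E; rewrite -[RHS]E; congr (_ + _).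
rewrite -sumrN; apply: eq_bigr => i iT.
by rewrite (negPf iT) mulNr mulrC.
Qed.

(** A functional vanishing on [B] has the form [y |-> (z * y) 1]. As [B] is a right ideal, the other
    coordinates of [z * x] then vanish too. *)
Lemma right_ideal_left_annihilator (B : crossed_product f -> Prop) :
  (forall x y, B x -> B y -> B (x + y)) -> (forall x y, B x -> B (x * y)) ->
  B 0 -> ~ B 1 -> exists2 z, z != 0 & forall x, B x -> z * x = 0.
Proof.
move=> BD BM B0 B1.
(* Scalars are written to the right of [U_g], so that right multiplication by a scalar is linear in
   the coordinates. *)
pose coord x g := sigma g^-1%g (x g).
pose W u := exists2 x, B x & coord x =1 u.
have coordU a x : coord (x * (a *: crossedU f 1%g)) =1 (fun g => coord x g * a).
  move=> g; rewrite /coord crossed_mul_monomialE invg1 mulg1 cocycle2_g1 mulr1.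
  by rewrite rmorphM -ractM mulVg ract1.
have [|||l [i li] lW] := @proper_subspace_functional gT W 1%g.
- by move=> u v uv [x Bx xu]; exists x => // g; rewrite xu.
- move=> a u v [x Bx xu] [y By yv].
  exists (x * (a *: crossedU f 1%g) + y); first by apply: BD => //; apply: BM.
  move=> g; rewrite /coord crossed_addE rmorphD /= -/(coord y g) yv.
  by rewrite -/(coord (x * (a *: crossedU f 1%g)) g) coordU xu mulrC.
- move=> [x Bx x1]; apply: B1; suff <- : x = 1 by [].
  apply/ffunP => g; have := congr1 (sigma g) (x1 g).
  rewrite /coord -ractM mulgV ract1 => ->; rewrite !ffunE.
  by case: eqP; rewrite ?rmorph1 ?rmorph0.
(* Chosen so that [(z * y) 1] is [l] applied to [coord y]. *)
pose z : crossed_product f := [ffun g => l g^-1%g / f g g^-1%g].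
exists z.
  apply/eqP => z0; have := congr1 (fun u : crossed_product f => u i^-1%g) z0.
  rewrite /= !ffunE invgK => /eqP; rewrite mulf_eq0 invr_eq0 (negPf li).
  by rewrite (negPf (cocycle_neq0 _ _ _)).
move=> x Bx.
have zx1 y : B y -> (z * y) 1%g = 0.
  move=> By; rewrite [LHS]crossed_mulE -[RHS](lW (coord y)); last by exists y.
  rewrite [RHS](reindex_inj invg_inj) /=; apply: eq_bigr => g _.
  by rewrite mulg1 ffunE /coord invgK mulrAC divfK ?cocycle_neq0.
apply/ffunP => g; have := zx1 _ (BM x (1 *: crossedU f g^-1%g) Bx).
rewrite mulrA crossed_mul_monomialE invgK mul1g rmorph1 mulr1 => /eqP.
by rewrite mulf_eq0 (negPf (cocycle_neq0 _ _ _)) orbF [RHS]ffunE => /eqP.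
Qed.

End CrossedFrobenius.

(** * Reduction modulo the maximal ideal *)

Section CrossedResidue.
Variables (S : dvrType) (gT : finGroupType) (sigma : ring_action gT S).
Variable f : cocycle2 sigma.

Fact res_cocycle_unit g h : res (f g h) \is a GRing.unit.
Proof. exact/rmorph_unit/cocycle2_unit. Qed.
Fact res_cocycleP g h k :
  res (f g h) * res (f (g * h)%g k) =
  res_action sigma g (res (f h k)) * res (f g (h * k)%g).
Proof. by rewrite res_actionE -!rmorphM cocycle2P. Qed.
Fact res_cocycle_1g g : res (f 1%g g) = 1.
Proof. by rewrite cocycle2_1g rmorph1. Qed.
Fact res_cocycle_g1 g : res (f g 1%g) = 1.
Proof. by rewrite cocycle2_g1 rmorph1. Qed.

Definition res_cocycle : cocycle2 (res_action sigma) :=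
  @Cocycle2 gT (residue S) (res_action sigma) (fun g h => res (f g h))
    res_cocycle_unit res_cocycleP res_cocycle_1g res_cocycle_g1.

Definition crossed_res (x : crossed_product f) : crossed_product res_cocycle :=
  [ffun g => res (x g)].

Fact crossed_res_is_zmod_morphism : zmod_morphism crossed_res.
Proof. by move=> x y; apply/ffunP => g; rewrite !ffunE rmorphB. Qed.
Fact crossed_res_is_monoid_morphism : monoid_morphism crossed_res.
Proof.
split=> [|x y]; apply/ffunP => k.
  by rewrite !ffunE; case: eqP; rewrite ?rmorph1 ?rmorph0.
rewrite ffunE !crossed_mulE rmorph_sum /=; apply: eq_bigr => g _.
by rewrite !ffunE !rmorphM /= -res_actionE.
Qed.
HB.instance Definition _ := GRing.isZmodMorphism.Build _ _ crossed_res
  crossed_res_is_zmod_morphism.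
HB.instance Definition _ := GRing.isMonoidMorphism.Build _ _ crossed_res
  crossed_res_is_monoid_morphism.

Implicit Types (g h c : gT) (a b s : S) (x y z : crossed_product f).
Local Notation "'U_ g" := (crossedU f g) (at level 8, g at level 2).

Lemma crossed_resZ a x : crossed_res (a *: x) = res a *: crossed_res x.
Proof. by apply/ffunP => g; rewrite !ffunE rmorphM. Qed.

Lemma crossed_resU g : crossed_res 'U_ g = crossedU res_cocycle g.
Proof. by apply/ffunP => h; rewrite !ffunE; case: eqP; rewrite ?rmorph1 ?rmorph0. Qed.

Lemma crossed_res_surj (y : crossed_product res_cocycle) :
  exists x, crossed_res x = y.
Proof.
exists [ffun g => repr (y g)]; apply/ffunP => g.
by rewrite !ffunE res_surj.
Qed.

Variable p : S.
Hypothesis p_unif : uniformizer p.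

Let p_neq0 : p != 0. Proof. by case: p_unif. Qed.

Lemma crossed_res_eq0P x : crossed_res x = 0 <-> exists z, x = p *: z.
Proof.
split=> [x0|[z ->]]; last first.
  by rewrite crossed_resZ (res_uniformizer p_unif) scale0r.
have dP g : exists d, x g = p * d.
  have /ffunP/(_ g) := x0; rewrite !ffunE => /(res_eq0P p_unif) [d].
  by rewrite expr1 => ->; exists d.
have [d dE] := boolp.choice dP; exists [ffun g => d g].
by apply/ffunP => g; rewrite crossed_scaleE ffunE dE.
Qed.

Lemma crossed_scalepI : injective (fun x => p *: x).
Proof.
move=> x y /ffunP xy; apply/ffunP => g; apply: (mulfI p_neq0).
by have := xy g; rewrite !crossed_scaleE.
Qed.

Hypothesis faithful_sigma : faithful_action sigma.
Hypothesis separable_residue : separable_ext (residue_fixed sigma).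

(** * Wild monomials of finite order modulo p *)

Section Monomial.
Variables (c : gT) (s : S).
Hypothesis c_wild : c \in wild_inertia sigma p.
Hypothesis c_neq1 : c != 1%g.
Local Notation X := (s *: 'U_ c).
Local Notation n := #[c]%g.
Hypothesis resXn : crossed_res X ^+ n = 1.

(* [X ^ n] is a scalar of S fixed by c and congruent to 1; no uniformizer is
   fixed by c, so it is even congruent to 1 modulo p^2. *)
Lemma monomial_power : exists b, X ^+ n = 1 + p ^+ 2 * b *: 1.
Proof.
have Xi i : exists b, X ^+ i = b *: 'U_ (c ^+ i)%g.
  elim: i => [|i [b IH]]; first by exists 1; rewrite scale1r crossedU1.
  by rewrite exprS IH crossedU_mul -expgS; eexists.
have [b bE] := Xi n; rewrite expg_order crossedU1 in bE.
have resb : res b = 1.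
  have := resXn; rewrite -rmorphXn bE /= crossed_resZ rmorph1 => /ffunP /(_ 1%g).
  by rewrite !ffunE eqxx mulr1.
have s0 : s != 0.
  apply/eqP => s0; have := resXn.
  rewrite s0 scale0r rmorph0 expr0n -[_ == 0%N]negbK -lt0n order_gt0 => /esym/eqP.
  by rewrite oner_eq0.
have cb : sigma c b = b.
  have : X * X ^+ n = X ^+ n * X by rewrite -exprS exprSr.
  rewrite bE crossed_monomial_mulZ mulr1 -scalerAl mul1r => /ffunP /(_ c).
  rewrite !crossed_scaleE ffunE eqxx mulr1; exact: mulIf.
have [u uE] : pow_dvd p 1 (b - 1).
  by apply/(res_eq0P p_unif); rewrite rmorphB /= resb rmorph1 subrr.
have [uU|uU] := boolP (u \is a GRing.unit).
  case/eqP: c_neq1; apply: (inertia_moves_uniformizer faithful_sigma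
    separable_residue (uniformizerMu p_unif uU)).
    exact: wild_sub_inertia c_wild.
  by rewrite expr1 in uE; rewrite -uE rmorphB rmorph1 /= cb.
have /(p_unif.2 _) [d dE] : u \in maxideal S by [].
exists d; rewrite bE; apply/eqP; rewrite addrC -subr_eq -[X in _ - X]scale1r -scalerBl.
by rewrite uE dE mulrA.
Qed.

(** By wildness [sigma c p = p + p^2 d], so [p] commutes with [X - 1] modulo [p^2]. *)
Lemma monomial_sub1_mulp z : exists w,
  (X - 1) * (p *: z) = p *: ((X - 1) * z) + p *: (p *: w).
Proof.
have [d] := (wild_inertiaP sigma p c).1 c_wild 1 1.
rewrite expr1 mulr1 => /eqP; rewrite subr_eq => /eqP dE.
exists (d *: (X * z)).
rewrite mulrBl crossed_monomial_mulZ dE mul1r mulrBl mul1r.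
by rewrite scalerDl scalerBr !scalerA expr2 -addrA addrC.
Qed.

(** Over the residue field this is [crossed_monomial_fixed]; lifting costs a multiple of [p]. *)
Lemma monomial_sub1_exact x : crossed_res ((X - 1) * x) = 0 ->
  exists y z, x = (\sum_(i < n) X ^+ i) * y + p *: z.
Proof.
rewrite mulrBl mul1r rmorphB rmorphM /= crossed_resZ crossed_resU.
move=> /eqP; rewrite subr_eq0 => /eqP /crossed_monomial_fixed [y0 xE].
have [y yE] := crossed_res_surj y0; exists y.
have /crossed_res_eq0P [z zE] : crossed_res (x - (\sum_(i < n) X ^+ i) * y) = 0.
  rewrite rmorphB rmorphM rmorph_sum /= yE xE.
  apply/eqP; rewrite subr_eq0; apply/eqP; congr (_ * _); apply: eq_bigr => i _.
  by rewrite rmorphXn /= crossed_resZ crossed_resU.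
by exists z; rewrite -zE addrC subrK.
Qed.

Variable J : crossed_product res_cocycle -> Prop.
Hypothesis J0 : J 0.
Hypothesis JD : forall u v, J u -> J v -> J (u + v).
Hypothesis JM : forall u v w, J u -> J (v * u * w).
Hypothesis JX : J (crossed_res X - 1).
Hypothesis n0 : n%:R = 0 :> residue S.

Let J_sum i : J (\sum_(j < i) crossed_res X ^+ j - i%:R).
Proof.
elim: i => [|i IH]; first by rewrite big_ord0 subr0.
rewrite big_ord_recr /= mulrSr opprD addrACA; apply: JD => //.
by rewrite subrX1 -[X in J X]mul1r mulrA; apply: JM.
Qed.

Let J_nu : J (crossed_res (\sum_(i < n) X ^+ i)).
Proof.
have := J_sum n; rewrite rmorph_sum /=.
have -> : n%:R = 0 :> crossed_product res_cocycle.
  by rewrite -scaler_nat n0 scale0r.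
by rewrite subr0; under [in X in _ -> X]eq_bigr => i _ do rewrite rmorphXn.
Qed.

(** The common end of the hereditary and maximal cases, each of which provides such a decomposition
    of [p]. *)
Lemma monomial_ideal_unit (r : seq (crossed_product f * crossed_product f)) :
  (forall u, u \in r -> J (crossed_res u.2) /\ crossed_res ((X - 1) * u.1) = 0) ->
  \sum_(u <- r) u.1 * u.2 = p *: 1 -> J 1.
Proof.
set nu := \sum_(i < n) X ^+ i => rJ rsum.
(* Each left factor is [nu y' + p z]; collecting terms keeps the coefficient [e] of [p] in [J]. *)
have {rJ} [y [e eJ rE]] : exists y, exists2 e, J (crossed_res e) &
    \sum_(u <- r) u.1 * u.2 = nu * y + p *: e.
  elim: r rJ {rsum} => [|u r IH] rJ.
    by exists 0; exists 0; rewrite ?rmorph0 // big_nil mulr0 scaler0 addr0.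
  have [|y [e eJ eE]] := IH; first by move=> v vr; apply: rJ; rewrite inE vr orbT.
  have [uJ /monomial_sub1_exact [y' [z uE]]] := rJ u (mem_head _ _).
  exists (y' * u.2 + y); exists (z * u.2 + e).
    rewrite rmorphD rmorphM /=; apply: JD => //.
    by rewrite -[X in J X]mulr1; apply: JM.
  rewrite big_cons eE uE mulrDl mulrDr scalerDr -scalerAl mulrA.
  by rewrite -!addrA; congr (_ + _); rewrite addrCA.
have [b bE] := monomial_power; have [w wE] := monomial_sub1_mulp (1 - e).
(* [p (1 - e) = nu y], and [(X - 1) nu = X^n - 1] is divisible by [p^2]; one factor [p] cancels. *)
have /monomial_sub1_exact [y' [z zE]] : crossed_res ((X - 1) * (1 - e)) = 0.
  apply/crossed_res_eq0P; exists (b *: y - w).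
  apply: crossed_scalepI; apply/eqP; rewrite scalerBr scalerBr eq_sym subr_eq -wE.
  rewrite scalerBr -rsum rE addrK mulrA -subrX1 bE addrAC subrr add0r.
  by rewrite -scalerAl mul1r !scalerA expr2.
have -> : 1 = crossed_res (1 - e) + crossed_res e by rewrite -rmorphD subrK rmorph1.
apply: JD => //; rewrite zE rmorphD rmorphM /=; apply: JD.
  by rewrite -[X in J X]mul1r mulrA; apply: JM.
by rewrite crossed_resZ (res_uniformizer p_unif) scale0r.
Qed.

End Monomial.
End CrossedResidue.

(** * Hereditary rings and maximal orders *)

Section TwoGeneratedIdeal.
Variables (B : nzRingType) (u v : B).

Definition left_ideal2 : {pred B^o} :=
  [pred x | `[< exists ab : B * B, x = ab.1 * u + ab.2 * v >]].

Fact left_ideal2_closed : submod_closed left_ideal2.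
Proof.
split; first by apply/asboolP; exists (0, 0); rewrite !mul0r addr0.
move=> a x y /asboolP [[b c] /= ->] /asboolP [[d e] /= ->]; apply/asboolP.
exists (a * b + d, a * c + e) => /=.
by rewrite /GRing.scale /= mulrDr !mulrDl !mulrA addrACA.
Qed.
HB.instance Definition _ := GRing.isSubmodClosed.Build B B^o left_ideal2
  left_ideal2_closed.

Definition left_ideal2_type := {x : B^o | x \in left_ideal2}.
HB.instance Definition _ := SubChoice.on left_ideal2_type.
HB.instance Definition _ := [SubChoice_isSubLmodule of left_ideal2_type by <:].

Fact left_ideal2_combP (ab : (B^o * B^o)%type) :
  (ab.1 : B) * u + (ab.2 : B) * v \in left_ideal2.
Proof. by apply/asboolP; exists ab. Qed.

Definition left_ideal2_comb (ab : (B^o * B^o)%type) : left_ideal2_type :=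
  Sub (_ : B^o) (left_ideal2_combP ab).

Fact left_ideal2_comb_linear : linear left_ideal2_comb.
Proof.
move=> a [b c] [d e]; apply: val_inj; rewrite linearP /= /GRing.scale /=.
by rewrite mulrDr !mulrDl !mulrA addrACA.
Qed.
HB.instance Definition _ := GRing.isLinear.Build B _ _ _ left_ideal2_comb
  left_ideal2_comb_linear.

(* [fu] and [fv] are the values at [u] and [v] of the two coordinate forms of a
   dual basis of the projective left ideal B u + B v. *)
Lemma left_hereditary_dual_basis : left_hereditary B ->
  exists fu fv : B * B, v = fv.1 * u + fv.2 * v /\
    forall a b, a * u + b * v = 0 ->
      a * fu.1 + b * fv.1 = 0 /\ a * fu.2 + b * fv.2 = 0.
Proof.
move=> /(_ left_ideal2 left_ideal2_type (B^o * B^o)%type left_ideal2_type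
  left_ideal2_comb idfun) [].
  move=> y; have /asboolP [ab yE] := valP y; exists ab.
  by apply: val_inj; rewrite /= yE.
(* [s] splits the surjection [(a, b) |-> a u + b v] from the free module. *)
move=> s sP; pose eu := left_ideal2_comb (1, 0); pose ev := left_ideal2_comb (0, 1).
exists (s eu), (s ev); split.
  have /(congr1 val) := sP ev.
  by rewrite [in X in _ = X -> _]/= mul0r add0r mul1r.
move=> a b ab0; have : s (a *: eu + b *: ev) = 0.
  rewrite [X in s X](_ : _ = 0) ?linear0 //; apply: val_inj.
  rewrite linearD !linearZ /= /GRing.scale /=.
  by rewrite !mul0r !mul1r add0r addr0 ab0.
by rewrite linearD !linearZ => -[].
Qed.
End TwoGeneratedIdeal.

(** * Finite generation and overrings of a maximal order *)

Section Span.
Variables (L : fieldType) (A : lalgType L).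
Implicit Types (C : {pred L}) (X : {pred A}) (x y : A).

Lemma in_span0 C X : in_span C X 0.
Proof. by exists [::]; split=> //; rewrite big_nil. Qed.

Lemma in_span1 C X a x : a \in C -> x \in X -> in_span C X (a *: x).
Proof.
move=> aC xX; exists [:: (a, x)]; split; last by rewrite big_seq1.
by move=> u; rewrite inE => /eqP ->.
Qed.

Lemma in_spanD C X x y : in_span C X x -> in_span C X y -> in_span C X (x + y).
Proof.
move=> [s [sP ->]] [t [tP ->]]; exists (s ++ t); split; last by rewrite big_cat.
by move=> u; rewrite mem_cat => /orP [/sP|/tP].
Qed.

Lemma in_span_sum C X (I : eqType) (r : seq I) (F : I -> A) :
  (forall i, i \in r -> in_span C X (F i)) -> in_span C X (\sum_(i <- r) F i).
Proof.
elim: r => [|i r IH] rP; first by rewrite big_nil; apply: in_span0.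
rewrite big_cons; apply: in_spanD; first exact/rP/mem_head.
by apply: IH => j jr; apply: rP; rewrite inE jr orbT.
Qed.

Lemma in_span_subset C X X' x : {subset X <= X'} -> in_span C X x -> in_span C X' x.
Proof. by move=> XX' [s [sP ->]]; exists s; split=> // u /sP [? /XX']. Qed.
End Span.

Section MaximalOrder.
Variables (S : dvrType) (gT : finGroupType) (sigma : ring_action gT S).
Variable f : cocycle2 sigma.
Variable p : S.
Hypothesis p_unif : uniformizer p.

Let p_neq0 : p != 0. Proof. by case: p_unif. Qed.
Let pF_neq0 : p%:F != 0 :> {fraction S}. Proof. by rewrite tofrac_eq0. Qed.

Local Notation L := {fraction S}.
Local Notation La := (crossed_product f).
Local Notation Q := (crossed_product (frac_cocycle f)).
Local Notation iota := (@crossed_incl S gT sigma f).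
Local Notation R := (frac_fixed_ring sigma).
Implicit Types (x y z b : La) (q e : Q).

Lemma crossed_incl_inj : injective iota.
Proof.
move=> x y /ffunP xy; apply/ffunP => g; have := xy g.
by rewrite !ffunE => /eqP; rewrite tofrac_eq => /eqP.
Qed.

Lemma crossed_inclZ (a : S) x : iota (a *: x) = a%:F *: iota x.
Proof. by apply/ffunP => g; rewrite !ffunE tofracM. Qed.

Lemma crossed_subP q : q \in crossed_sub f <-> exists x, q = iota x.
Proof. by split=> /asboolP. Qed.

(** Although [p] is not central, it is a multiple of each [sigma g p], and the coordinate of [e * p]
    at [g] is [e g * sigma g p]. *)
Lemma crossed_sub_bounded e :
  (exists z, e * iota (p *: 1) = iota z) -> exists z, p%:F *: e = iota z.
Proof.
move=> [z eE]; have vP g : exists v, p = sigma g p * v.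
  have [d] : pow_dvd p 1 (sigma g^-1%g p).
    by apply: pow_dvd_ract => //; exists 1; rewrite mulr1.
  move/(congr1 (sigma g)); rewrite expr1 -ractM mulgV ract1 rmorphM => dE.
  by exists (sigma g d).
have [v vE] := boolp.choice vP.
exists [ffun g => v g * z g]; apply/ffunP => g.
have := congr1 (fun q => q g) eE; rewrite crossed_inclZ rmorph1 -[1 in LHS]crossedU1.
rewrite /= crossed_mul_monomialE invg1 mulg1 cocycle2_g1 mulr1 frac_actionE.
rewrite !ffunE tofracM => <-; rewrite {1}(vE g) tofracM.
by ring.
Qed.

Let S_pred : {pred L} := [pred y | `[< exists a : S, y = a%:F >]].

(* Induction on the support: the coordinates at a given point form a principal
   ideal of S, and a generator of it splits off one element. *)
Lemma bounded_submodule_fg (X : Q -> Prop) :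
  X 0 -> (forall x y : Q, X x -> X y -> X (x + y)) ->
  (forall (a : S) (x : Q), X x -> X (a%:F *: x)) ->
  (forall (x : Q), X x -> exists z, p%:F *: x = iota z) ->
  exists2 gens : seq Q, (forall (x : Q), x \in gens -> X x) &
    forall x : Q, X x -> in_span S_pred (mem gens) x.
Proof.
move=> X0 XD XZ Xp.
suff Xs (gs : seq gT) : exists2 gens : seq Q, (forall (x : Q), x \in gens -> X x) &
    forall x : Q, X x -> (forall g, g \notin gs -> x g = 0) ->
    in_span S_pred (mem gens) x.
  have [gens gX gP] := Xs (enum gT); exists gens => // x Xx.
  by apply: gP => // g; rewrite mem_enum.
elim: gs => [|g gs [gens gensX gensP]].
  exists [::] => // x _ x0; have -> : x = 0 by apply/ffunP => g; rewrite x0 // ffunE.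
  exact: in_span0.
pose Xg (x : Q) := X x /\ forall h, h \notin g :: gs -> x h = 0.
pose I : {pred S} := [pred a | `[< exists2 x : Q, Xg x & p%:F * x g = a%:F >]].
have I0 : 0 \in I.
  apply/asboolP; exists 0; last by rewrite ffunE mulr0 tofrac0.
  by split=> // h _; rewrite ffunE.
have I_lin (a : S) : {in I &, forall u v, a * u + v \in I}.
  move=> u v /asboolP [x [Xx x0] xu] /asboolP [y [Xy y0] yv]; apply/asboolP.
  exists (a%:F *: x + y).
    split=> [|h hg]; first by apply: XD => //; apply: XZ.
    by rewrite crossed_addE crossed_scaleE x0 // y0 // mulr0 addr0.
  by rewrite crossed_addE crossed_scaleE mulrDr mulrCA xu yv tofracD tofracM.
have [a aI aP] : exists2 a, a \in I & forall u, u \in I -> exists v : S, u = v * a.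
  (* [dvr_principal] speaks of proper ideals, so the unit ideal is treated apart. *)
  have [I1|I1] := boolP (1 \in I).
    by exists 1 => // u _; exists u; rewrite mulr1.
  have [a aP] := dvr_principal I (And3 I0 I1 I_lin).
  by exists a => [|u /aP //]; apply/aP; exists 1; rewrite mul1r.
have /asboolP [x0 [Xx0 x0g] x0a] := aI.
exists (x0 :: gens) => [x|x Xx xg].
  by rewrite inE => /orP [/eqP ->|/gensX].
have [z zE] := Xp x Xx.
have /aP [y yE] : z g \in I.
  apply/asboolP; exists x => //; have := congr1 (fun q => q g) zE.
  by rewrite /= crossed_scaleE [RHS]ffunE.
have xE : x = y%:F *: x0 + (x + (- y)%:F *: x0).
  by rewrite tofracN scaleNr addrC subrK.
rewrite xE; apply: in_spanD.
  by apply: in_span1; [apply/asboolP; exists y | apply: mem_head].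
have gens_sub : {subset mem gens <= mem (x0 :: gens)}.
  by move=> u; rewrite !inE => ->; rewrite orbT.
apply: in_span_subset gens_sub _; apply: gensP => [|h hg].
  by apply: XD => //; apply: XZ.
have [->|hg'] := eqVneq h g; last first.
  have hgs : h \notin g :: gs by rewrite inE negb_or hg'.
  by rewrite crossed_addE crossed_scaleE xg // x0g // mulr0 addr0.
rewrite crossed_addE crossed_scaleE; apply: (mulfI pF_neq0).
rewrite mulr0 mulrDr mulrCA x0a tofracN mulNr -tofracM -yE.
have := congr1 (fun q => q g) zE; rewrite /= crossed_scaleE => ->.
by rewrite [iota z g]ffunE subrr.
Qed.

(** The identity coordinates of [R]-generators of the order generate [S] over [R]. This turns finite
    generation over [S] into finite generation over [R]. *)
Lemma order_coef_fg : is_order R (crossed_sub f) ->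
  exists s : seq S, forall a : S, exists r : seq (L * S),
    (forall u, u \in r -> u.1 \in R /\ u.2 \in s) /\
    a%:F = \sum_(u <- r) u.1 * (u.2)%:F.
Proof.
move=> [_ [gens gensP] _].
have R1 : 1 \in R.
  apply/asboolP; exists 1; last by rewrite tofrac1.
  by apply/forallP => g; rewrite rmorph1.
have gE q : q \in gens -> exists a : S, q 1%g = a%:F.
  move=> qg; have /crossed_subP [x ->] : q \in crossed_sub f.
    by apply/gensP; rewrite -[q]scale1r; apply: in_span1.
  by exists (x 1%g); rewrite ffunE.
have /boolp.choice [c cE] : forall q, exists a : S, q \in gens -> q 1%g = a%:F.
  by move=> q; have [/gE [a]|_] := boolP (q \in gens); [exists a | exists 0].
exists (map c gens) => a.
have /gensP [r [rP rE]] : iota (a *: 1) \in crossed_sub f.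
  by apply/crossed_subP; exists (a *: 1).
exists [seq (u.1, c u.2) | u <- r]; split=> [_ /mapP [u ur ->] /=|].
  by have [? ?] := rP u ur; split=> //; apply: map_f.
have := congr1 (fun q => q 1%g) rE; rewrite sum_ffunE /= !ffunE eqxx mulr1 => ->.
rewrite big_map big_seq [RHS]big_seq; apply: eq_bigr => u ur.
by have [_ /cE uE] := rP u ur; rewrite crossed_scaleE uE.
Qed.

Hypothesis La_max : is_maximal_order R (crossed_sub f).

(** A ring between the crossed product and its multiple by [p^-1] is finitely generated over [S],
    hence over [R]; it is therefore an order. *)
Lemma maximal_order_overring (G : {pred Q}) : GRing.subring_closed G ->
  (forall x, iota x \in G) ->
  (forall e, e \in G -> exists z, p%:F *: e = iota z) ->
  forall e, e \in G -> exists z, e = iota z.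
Proof.
move=> G_ring LaG Gp e eG; have [La_order Lamax] := La_max.
suff G_order : is_order R G.
  by apply/crossed_subP; apply: (Lamax G) => // _ /crossed_subP [x ->].
have [_ _ La_span] := La_order.
have GD (x y : Q) : x \in G -> y \in G -> x + y \in G by case: G_ring => _ B _ xG yG;
  rewrite -[y]opprK B // -sub0r B // -(subrr y) B.
have G0 : 0 \in G by rewrite -(rmorph0 iota) LaG.
have GZ (a : S) (x : Q) : x \in G -> a%:F *: x \in G.
  case: G_ring => _ _ M xG.
  by have := M _ _ (LaG (a *: 1)) xG; rewrite crossed_inclZ rmorph1 -scalerAl mul1r.
split=> //; last first.
  move=> x; apply: in_span_subset (La_span x) => _ /crossed_subP [y ->].
  exact: LaG.
have [gens gensG gensP] := @bounded_submodule_fg (fun q => q \in G) G0 GD GZ Gp.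
have [s sP] := order_coef_fg La_order.
exists [seq a%:F *: q | a <- s, q <- gens] => x; split=> [/gensP|].
  move=> [t [tP ->]]; apply: in_span_sum => -[a y] /tP /= [/asboolP [b ->] yg].
  have [r [rP ->]] := sP b; rewrite scaler_suml; apply: in_span_sum => u ur.
  have [uR us] := rP u ur; rewrite -scalerA; apply: in_span1 => //.
  by apply/allpairsP; exists (u.2, y).
move=> [t [tP ->]]; rewrite big_seq.
apply: (big_ind (fun q : Q => q \in G)) => // -[a y] /tP /= [aR].
move=> /allpairsP [[b z] /= [_ zg ->]].
have /asboolP [r _ ->] := aR; apply/GZ/GZ; exact: gensG.
Qed.

(** * Inverting a two-sided ideal over a maximal order *)

Variable J : crossed_product (res_cocycle f) -> Prop.
Hypothesis J0 : J 0.
Hypothesis JD : forall u v, J u -> J v -> J (u + v).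
Hypothesis JM : forall u v w, J u -> J (v * u * w).

Let JN u : J u -> J (- u).
Proof. by move=> /(JM (-1) 1); rewrite mulr1 mulN1r. Qed.

Let Jp x : J (crossed_res (p *: x)).
Proof. by rewrite crossed_resZ (res_uniformizer p_unif) scale0r. Qed.

(** The fractional inverse [J'^-1] of the preimage [J'] of [J]. *)
Definition ideal_inv q : Prop :=
  forall x, J (crossed_res x) -> exists z, q * iota x = iota z.

(** [x q] maps [J'] into itself. The left order [G] of [J'] is bounded because [p] lies in [J'], so
    maximality applies. *)
Lemma ideal_inv_left x q : ideal_inv q -> J (crossed_res x) ->
  exists z, iota x * q = iota z.
Proof.
move=> qJ xJ; pose G : {pred Q} := [pred e | `[< forall x, J (crossed_res x) ->
  exists2 z, J (crossed_res z) & e * iota x = iota z >]].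
apply: (@maximal_order_overring G).
- split=> [|e e' /asboolP eG /asboolP e'G|e e' /asboolP eG /asboolP e'G];
    apply/asboolP => y yJ.
  + by exists y; rewrite ?mul1r.
  + have [[z zJ zE] [z' z'J z'E]] := (eG y yJ, e'G y yJ); exists (z - z').
      by rewrite rmorphB; apply: JD => //; apply: JN.
    by rewrite mulrBl zE z'E rmorphB.
  + have [z zJ zE] := e'G y yJ; have [z' z'J z'E] := eG z zJ.
    by exists z'; rewrite // -mulrA zE.
- move=> y; apply/asboolP => z zJ; exists (y * z); last by rewrite rmorphM.
  by rewrite rmorphM -[X in J X]mulr1; apply: JM.
- move=> e /asboolP eG; apply: crossed_sub_bounded.
  by have [z _ zE] := eG _ (Jp 1); exists z.
apply/asboolP => y yJ; have [z zE] := qJ y yJ; exists (x * z).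
  by rewrite rmorphM -[X in J X]mul1r mulrA; apply: JM.
by rewrite -mulrA zE rmorphM.
Qed.

Lemma ideal_inv1 : ideal_inv 1.
Proof. by move=> x _; exists x; rewrite mul1r. Qed.

Let inv_prod b : Prop := exists r : seq (Q * La),
  (forall u, u \in r -> ideal_inv u.1 /\ J (crossed_res u.2)) /\
  iota b = \sum_(u <- r) u.1 * iota u.2.

(** Otherwise [J'^-1 J'] is a proper right ideal modulo [p], killed on the left by some [z] nonzero
    modulo [p]. Then [p^-1 z] maps [J'^-1] into itself, hence is integral by maximality, and [z] is
    0 modulo [p]. *)
Lemma maximal_order_inv_prod1 : inv_prod 1.
Proof.
pose B u := exists2 b, inv_prod b & crossed_res b = u.
have [B1|nB1] := pselect (B 1).
  have [b [r [rP rE]] b1] := B1.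
  have /(crossed_res_eq0P p_unif) [w wE] : crossed_res (1 - b) = 0.
    by rewrite rmorphB rmorph1 /= b1 subrr.
  exists ((1, p *: w) :: r); split=> [u|].
    rewrite inE => /orP [/eqP ->|/rP //]; split; last exact: Jp.
    exact: ideal_inv1.
  by rewrite big_cons mul1r -rE -wE -rmorphD subrK.
have BD u v : B u -> B v -> B (u + v).
  move=> [b [r [rP rE]] <-] [b' [r' [r'P r'E]] <-]; exists (b + b').
    exists (r ++ r'); split; last by rewrite big_cat /= rmorphD /= rE r'E.
    by move=> w; rewrite mem_cat => /orP [/rP|/r'P].
  by rewrite rmorphD.
have BM u v : B u -> B (u * v).
  move=> [b [r [rP rE]] <-]; have [y <-] := crossed_res_surj v.
  exists (b * y); last by rewrite rmorphM.
  exists [seq (u.1, u.2 * y) | u <- r]; split=> [_ /mapP [w /rP [w1 w2] ->] /=|].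
    by split=> //; have := JM 1 (crossed_res y) w2; rewrite mul1r rmorphM.
  rewrite big_map rmorphM /= rE mulr_suml; apply: eq_bigr => w _.
  by rewrite rmorphM mulrA.
have B0 : B 0.
  exists 0; last exact: rmorph0.
  by exists [::]; split; rewrite // big_nil rmorph0.
have [z0 z0_neq0 z0B] := right_ideal_left_annihilator BD BM B0 nB1.
have [z zE] := crossed_res_surj z0; case/eqP: z0_neq0; rewrite -zE.
(* The left order of [J'^-1]. *)
pose G : {pred Q} := [pred e | `[< forall q, ideal_inv q -> ideal_inv (e * q) >]].
have [] := @maximal_order_overring G _ _ _ (p%:F^-1 *: iota z).
- split=> [|e e' /asboolP eG /asboolP e'G|e e' /asboolP eG /asboolP e'G];
    apply/asboolP => q qJ.
  + by rewrite mul1r.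
  + move=> x xJ; have [[w wE] [w' w'E]] := (eG q qJ x xJ, e'G q qJ x xJ).
    by exists (w - w'); rewrite 2!mulrBl wE w'E rmorphB.
  + by rewrite -mulrA; apply/eG/e'G.
- move=> y; apply/asboolP => q qJ x xJ; have [w wE] := qJ x xJ.
  by exists (y * w); rewrite -mulrA wE rmorphM.
- move=> e /asboolP /(_ 1 ideal_inv1); rewrite mulr1 => eJ.
  exact/crossed_sub_bounded/eJ.
- apply/asboolP => q qJ x xJ; have [b bE] := qJ x xJ.
  have /(crossed_res_eq0P p_unif) [w wE] : crossed_res (z * b) = 0.
    rewrite rmorphM /= zE z0B //; exists b => //; exists [:: (q, x)].
    by split=> [u|]; rewrite ?big_seq1 // inE => /eqP ->.
  exists w; rewrite -2!scalerAl -mulrA bE -rmorphM wE /= crossed_inclZ scalerA.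
  by rewrite mulVf // scale1r.
move=> w wE; apply/(crossed_res_eq0P p_unif); exists w; apply: crossed_incl_inj.
by rewrite crossed_inclZ -wE scalerA mulfV // scale1r.
Qed.

(** Multiply [1 = sum q_i a_i] by [p]: the left factors [p q_i] are integral by [ideal_inv_left], as
    [p] lies in [J']. *)
Lemma maximal_order_dual_basis : exists r : seq (La * La),
  (forall u, u \in r -> J (crossed_res u.2) /\
     exists q, iota u.1 = p%:F *: q /\
     forall y, J (crossed_res y) -> exists z, iota y * q = iota z) /\
  \sum_(u <- r) u.1 * u.2 = p *: 1.
Proof.
have [r [rP rE]] := maximal_order_inv_prod1.
suff [t [tP tE]] : exists t : seq (La * La),
  (forall u, u \in t -> J (crossed_res u.2) /\
     exists q, iota u.1 = p%:F *: q /\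
     forall y, J (crossed_res y) -> exists z, iota y * q = iota z) /\
  iota (\sum_(u <- t) u.1 * u.2) = p%:F *: \sum_(u <- r) u.1 * iota u.2.
  by exists t; split=> //; apply: crossed_incl_inj; rewrite tE -rE -crossed_inclZ.
elim: r rP {rE} => [|u r IH] rP.
  by exists [::]; split; rewrite // !big_nil rmorph0 scaler0.
have [|t [tP tE]] := IH; first by move=> v vr; apply: rP; rewrite inE vr orbT.
have [u1 u2] := rP u (mem_head _ _).
have [a aE] := ideal_inv_left u1 (Jp 1).
rewrite crossed_inclZ rmorph1 -scalerAl mul1r in aE.
exists ((a, u.2) :: t); split=> [v|].
  rewrite inE => /orP [/eqP -> /=|/tP //]; split=> //; exists u.1; split=> //.
  by move=> y; apply: ideal_inv_left.
by rewrite !big_cons rmorphD rmorphM /= tE -aE scalerDr -scalerAl.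
Qed.

End MaximalOrder.

(** * Commutators of inertia elements *)

Section WildMonomial.
Variables (S : dvrType) (gT : finGroupType) (sigma : ring_action gT S).
Variable f : cocycle2 sigma.
Variable p : S.
Hypothesis p_unif : uniformizer p.
Hypothesis faithful_sigma : faithful_action sigma.
Local Notation L := (crossed_product f).
Local Notation "'U_ g" := (crossedU f g) (at level 8, g at level 2).

Lemma res_act_inertia g : g \in inertia sigma ->
  forall x, res_action sigma g x = x.
Proof. by rewrite inE => /asboolP. Qed.

Lemma wild_inertia_pgroup q : q \in [pchar (residue S)] ->
  (q.-group (wild_inertia sigma p))%g.
Proof.
move=> qk; apply/pgroupP => r r_pr rN.
have [g gN gr] := Cauchy r_pr rN.
have g1 : g != 1%g by rewrite -order_gt1 gr prime_gt1.
have := wild_inertia_order faithful_sigma p_unif gN g1.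
rewrite gr => /eqP; rewrite -(dvdn_pcharf qk) dvdn_prime2 // => [/eqP ->|].
  by rewrite inE.
exact: pcharf_prime qk.
Qed.

(** A nontrivial commutator [d] is wild and has a power [c] of prime order, which must be the
    residue characteristic. Being a power of a commutator, [c] meets the hypothesis of
    [crossed_monomial_pth_root]. *)
Lemma nonabelian_inertia_wild_monomial : ~~ abelian (inertia sigma) ->
  exists c s, [/\ c \in wild_inertia sigma p, c != 1%g,
     #[c]%g \in [pchar (residue S)] & crossed_res (s *: 'U_ c) ^+ #[c]%g = 1].
Proof.
pose fbar := res_cocycle f.
have I_group : group_set (inertia sigma).
  apply/group_setP; split=> [|g h /inertiaP gI /inertiaP hI]; apply/inertiaP => z.
    by rewrite ract1.
  by rewrite ractM gI hI.
pose I := Group I_group.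
have Itriv g : g \in I -> forall a, res_action sigma g a = a.
  exact: res_act_inertia.
move=> nab; have [g [h [gI hI gh1]]] : exists g h,
    [/\ g \in I, h \in I & [~ g, h]%g != 1%g].
  apply: contra_notP (negP nab) => all1; apply/centsP => g gI h hI.
  by apply/commgP; apply: contra_notT all1 => gh; exists g, h.
have [a a0 aP] := cocycle_prod_commg fbar Itriv gI hI.
set d := [~ g, h]%g in gh1 aP.
have dN : d \in wild_inertia sigma p by apply: inertia_commg_wild.
have [q q_pr qd] : exists2 q, prime q & (q %| #[d]%g)%N.
  by exists (pdiv #[d]%g); rewrite ?pdiv_dvd // pdiv_prime // order_gt1.
pose i := (#[d]%g %/ q)%N; pose c := (d ^+ i)%g.
have cq : #[c]%g = q.
  by rewrite /c orderXdiv ?dvdn_div // divnA ?mulKn ?order_gt0.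
have c1 : c != 1%g by rewrite -order_gt1 cq prime_gt1.
have cN : c \in wild_inertia sigma p by apply: groupX.
have qk : q \in [pchar (residue S)].
  rewrite inE q_pr -cq /=; apply/eqP.
  exact: (wild_inertia_order faithful_sigma p_unif).
have dI : d \in I by apply: wild_sub_inertia dN.
have cI : c \in I by apply: groupX.
have [b _ bP] := exprU_cocycle_prod fbar Itriv i dI.
have [s _ sP] : exists2 s, s != 0 & (s *: crossedU fbar c) ^+ q = 1.
  have b0 : b != 0.
    have := expf_neq0 i (cocycle_prod_neq0 fbar I d).
    by rewrite -bP mulf_eq0 negb_or expf_eq0 cardG_gt0 => /andP [].
  (* The scalar comes from [(a U_d)^i = a^i b U_c]. *)
  apply: (@crossed_monomial_pth_root _ _ _ fbar I Itriv q qk c (a ^+ i * b)) => //.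
    by rewrite mulf_neq0 // expf_neq0.
  by rewrite exprMn -mulrA bP exprAC -exprMn aP expr1n.
exists c, (repr s); split=> //; first by rewrite cq.
by rewrite crossed_resZ crossed_resU res_surj cq.
Qed.

End WildMonomial.

(** * Left factors killed by X - 1 modulo p *)

Section WildMonomialAnnihilator.
Variables (S : dvrType) (gT : finGroupType) (sigma : ring_action gT S).
Variable f : cocycle2 sigma.
Variable p : S.
Hypothesis p_unif : uniformizer p.
Variables (c : gT) (s : S).
Hypothesis c_wild : c \in wild_inertia sigma p.
Local Notation "'U_ g" := (crossedU f g) (at level 8, g at level 2).
Local Notation X := (s *: 'U_ c).

Let wild_p : exists d, sigma c p = p + p ^+ 2 * d.
Proof.
have [d] := (wild_inertiaP sigma p c).1 c_wild 1 1.
by rewrite expr1 mulr1 => /eqP; rewrite subr_eq addrC => /eqP ->; exists d.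
Qed.

Let res_wild_p : res (sigma c p) = 0.
Proof.
have [d ->] := wild_p.
by rewrite rmorphD rmorphM rmorphXn /= (res_uniformizer p_unif) expr0n mul0r addr0.
Qed.

(** With [sigma c p = p + p^2 d], the relation [sigma c p (X - 1) = (X - 1 - p d) p] passes to the
    coordinate forms of the left ideal generated by [X - 1] and [p]; [A] and [B] are their values at
    [p]. *)
Lemma hereditary_annihilator : left_hereditary (crossed_product f) ->
  exists A B : crossed_product f,
  [/\ crossed_res ((X - 1) * A) = 0, crossed_res ((X - 1) * B) = 0 &
      A * (X - 1) + B * (p *: 1) = p *: 1].
Proof.
move=> /(left_hereditary_dual_basis (X - 1) (p *: 1)) [fu [fv [fvE fP]]].
exists fv.1, fv.2; have [d dE] := wild_p.
have [] := fP (- (sigma c p *: 1)) ((X - 1) - (p * d) *: 1).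
  have dpE : (p * d) *: (p *: 1) = sigma c p *: 1 - p *: 1 :> crossed_product f.
    by rewrite scalerA -scalerBl dE; congr (_ *: _); ring.
  rewrite mulNr -!scalerAl mul1r mulrBl mulrBl mul1r -!scalerAl mul1r dpE.
  rewrite -/X scalerAl crossed_monomial_mulZ mulr1 scalerBr.
  by rewrite [- (_ - p *: 1)]opprB subrKA addNr.
have kill u v : - (sigma c p *: 1) * u + (X - 1 - (p * d) *: 1) * v = 0 ->
    crossed_res ((X - 1) * v) = 0.
  rewrite mulNr mulrBl -!scalerAl !mul1r addrCA => /eqP.
  rewrite addr_eq0 opprD !opprK => /eqP ->.
  rewrite rmorphD /= !crossed_resZ res_wild_p rmorphM /= (res_uniformizer p_unif).
  by rewrite mul0r !scale0r addr0.
by move=> /kill fv1 /kill fv2; split.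
Qed.

(** [(X - 1) (p q) = sigma c p (X - 1) q + p d (p q)] when [sigma c p = p + p^2 d]. *)
Lemma maximal_annihilator (A : crossed_product f) q :
  crossed_incl A = p%:F *: q ->
  (exists z, crossed_incl (X - 1) * q = crossed_incl z) ->
  crossed_res ((X - 1) * A) = 0.
Proof.
move=> AE [z zE]; have [d dE] := wild_p.
have -> : (X - 1) * A = sigma c p *: z + (p * d) *: A.
  apply: crossed_incl_inj; rewrite rmorphM [RHS]rmorphD /=.
  rewrite (crossed_inclZ _ z) (crossed_inclZ _ A) AE -zE.
  have -> : crossed_incl (X - 1) = s%:F *: crossedU (frac_cocycle f) c - 1.
    rewrite rmorphB rmorph1 /= crossed_inclZ; congr (_ *: _ - _).
    by apply/ffunP => g; rewrite !ffunE; case: eqP; rewrite ?tofrac1 ?tofrac0.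
  rewrite !mulrBl !mul1r crossed_monomial_mulZ frac_actionE.
  rewrite scalerBr -addrA; congr (_ + _).
  by rewrite scalerA -scaleNr -scalerDl -scaleNr dE; congr (_ *: _);
    rewrite -!tofracN -?tofracM -?tofracD; congr (_ %:F); ring.
rewrite rmorphD /= !crossed_resZ res_wild_p rmorphM /= (res_uniformizer p_unif).
by rewrite mul0r !scale0r addr0.
Qed.

End WildMonomialAnnihilator.

Theorem theoremA (S : dvrType) (gT : finGroupType) (sigma : ring_action gT S)
  (faithful_sigma : faithful_action sigma)
  (separable_residue : separable_ext (residue_fixed sigma))
  (f : cocycle2 sigma) :
  is_maximal_order (frac_fixed_ring sigma) (crossed_sub f) \/
  (is_order (frac_fixed_ring sigma) (crossed_sub f) /\
   hereditary (crossed_product f)) ->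
  abelian (inertia sigma).
Proof.
move=> La_hyp; apply/idPn => nab.
have [p p_unif] := uniformizer_exists S.
have [c [s [cN c1 ck Xn]]] :=
  nonabelian_inertia_wild_monomial f p_unif faithful_sigma nab.
pose N := wild_inertia_group sigma p_unif.
have Ntriv g : g \in N -> forall a, res_action sigma g a = a.
  by move=> /(wild_sub_inertia p_unif); apply: res_act_inertia.
have pN : (#[c].-group N)%g := wild_inertia_pgroup p_unif faithful_sigma ck.
pose J := frob_ideal (f := res_cocycle f) N.
have J0 : J 0 by exact: (@frob_ideal0 _ _ _ _ N _ ck pN).
have JD u v : J u -> J v -> J (u + v) by exact: (@frob_idealD _ _ _ _ N _ ck pN).
have JM u v w : J u -> J (v * u * w) by exact: frob_idealM.
have JX : J (crossed_res (s *: crossedU f c) - 1).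
  rewrite /J crossed_resZ crossed_resU; rewrite crossed_resZ crossed_resU in Xn.
  by apply: (frob_ideal_monomial Ntriv ck pN) Xn => // g h; apply: wild_inertia_conj.
have n0 : #[c]%g%:R = 0 :> residue S by apply/eqP; case/andP: ck.
have J1 : ~ J 1 by exact: (@frob_ideal1 _ _ _ _ N).
clearbody J; apply: J1; have core := monomial_ideal_unit p_unif faithful_sigma
  separable_residue cN c1 Xn J0 JD JM JX n0.
have JXi : J (crossed_res (s *: crossedU f c - 1)) by rewrite rmorphB rmorph1.
case: La_hyp => [La_max|[_ [La_hered _]]].
  have [r [rP rE]] := maximal_order_dual_basis p_unif La_max J0 JD JM.
  apply: (core r) rE => u /rP [uJ [q [uE qP]]]; split=> //.
  exact: (maximal_annihilator p_unif cN uE (qP _ JXi)).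
have [A [B [A0 B0 AB]]] := hereditary_annihilator p_unif s cN La_hered.
(* Here the two generators of the left ideal serve as the right factors in [J]. *)
apply: (core [:: (A, s *: crossedU f c - 1); (B, p *: 1)]); last first.
  by rewrite big_cons big_seq1.
move=> u; rewrite inE => /orP [/eqP -> //|]; rewrite inE => /eqP ->; split=> //.
by rewrite crossed_resZ (res_uniformizer p_unif) scale0r.
Qed.
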